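(* Let $2\le n\le\infty$ (where $I^\infty$ is the Hilbert cube). Each of the families $\mathcal{W}$ (Wilder continua in $I^n$), $\mathcal{CW}$ (continuum-wise Wilder continua in $I^n$), $\mathcal{AC}$ (nondegenerate arcwise connected continua in $I^n$) and $\mathcal{HA}$ (nondegenerate hereditarily arcwise connected continua in $I^n$) is contained in the family $\mathcal{D}(I^n)$ of all decomposable subcontinua of $I^n$; moreover, if $n\ge 3$, then $\mathcal{D}(I^n)$ is a $\sigma Z$-set in $C(I^n)$.
   Context: All spaces are separable metric. $I=[0,1]$; $I^n$ is the $n$-cube for finite $n$, and $I^\infty$ is the Hilbert cube. A continuum is a nonempty compact connected space (one-point continua are allowed); nondegenerate means having more than one point. A continuum is decomposable if it is the union of two proper subcontinua. For a space $X$, $C(X)$ denotes the space of all subcontinua of $X$ with the Hausdorff metric; for $2\le n\le \infty$, $C(I^n)$ is homeomorphic to the Hilbert cube. A space $X$ has the Wilder property if it has at least three points and for any mutually distinct points $x,y,z\in X$ there exists a continuum $K\subset X$ containing $x$ and exactly one of the points $y,z$. A Wilder continuum is a continuum with the Wilder property. A space $X$ has the continuum-wise Wilder property if it contains at least three points and for any mutually disjoint subcontinua $A,B,C$ of $X$ there exists a subcontinuum $L\supset A$ of $X$ containing exactly one of $B,C$ and disjoint from the other one (i.e. either $B\subset L$ and $C\cap L=\emptyset$, or $C\subset L$ and $B\cap L=\emptyset$). A continuum-wise Wilder continuum is a continuum with this property. A continuum is hereditarily arcwise connected if each of its subcontinua is arcwise connected. Let $X$ be a space homeomorphic to the Hilbert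 cube, with metric $d$. A closed subset $A\subset X$ is a $Z$-set in $X$ if for every $\epsilon>0$ there is a continuous $f:X\to X$ with $f(X)\cap A=\emptyset$ and $\sup\{d(f(x),x):x\in X\}<\epsilon$. A $\sigma Z$-set in $X$ is a countable union of $Z$-sets in $X$. *)

(* Defs.v *)
From HB Require Import structures.
From mathcomp Require Import all_boot all_order all_algebra.
From mathcomp Require Import all_classical all_reals all_analysis.
From mathcomp Require Import lra.

Set Implicit Arguments.
Unset Strict Implicit.
Unset Printing Implicit Defensive.

Import Order.TTheory GRing.Theory Num.Theory.
Import numFieldTopology.Exports numFieldNormedType.Exports.

Local Open Scope classical_set_scope.
Local Open Scope ring_scope.

(* All the notions below are for a subset [A] of an ambient space [T], seen as
   a space in its own right: a continuum contained in [A] is the same thing as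
   a subcontinuum of the space [A]. *)
Section continua.
Variable T : topologicalType.
Implicit Types A : set T.

Definition continuum A := [/\ A !=set0, compact A & connected A].

Definition nondegenerate A := exists x y, [/\ A x, A y & x <> y].

Definition at_least_three_points A :=
  exists x y z, [/\ A x, A y & A z] /\ [/\ x <> y, y <> z & x <> z].

Definition decomposable A :=
  exists H K, [/\ continuum H, continuum K, H `<` A, K `<` A & A = H `|` K].

Definition wilder A :=
  at_least_three_points A /\
  forall x y z, A x -> A y -> A z -> x <> y -> y <> z -> x <> z ->
    exists K, [/\ K `<=` A, continuum K, K x &
                  (K y /\ ~ K z) \/ (K z /\ ~ K y)].

Definition cw_wilder A :=
  at_least_three_points A /\
  forall P Q S : set T,
    [/\ continuum P, continuum Q & continuum S] ->
    [/\ P `<=` A, Q `<=` A & S `<=` A] ->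
    [/\ P `&` Q = set0, Q `&` S = set0 & P `&` S = set0] ->
    exists L, [/\ L `<=` A, continuum L, P `<=` L &
                  (Q `<=` L /\ S `&` L = set0) \/
                  (S `<=` L /\ Q `&` L = set0)].

(* [J] is an arc with end points [x] and [y]: [f] and [g] are mutually inverse
   homeomorphisms between [0, 1] and [J] *)
Definition is_arc (R : realType) (x y : T) (J : set T) :=
  exists (f : R -> T) (g : T -> R),
    [/\ {within `[0, 1], continuous f}, {within J, continuous g},
        f @` `[0, 1] = J, {in `[0, 1], cancel f g} & f 0 = x /\ f 1 = y].

Definition arcwise_connected (R : realType) A :=
  forall x y, A x -> A y -> x <> y -> exists2 J, is_arc R x y J & J `<=` A.

Definition hereditarily_arcwise_connected (R : realType) A :=
  forall K, K `<=` A -> continuum K -> arcwise_connected R K.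

End continua.

Section Z_sets.
Context {R : realType} {X : metricType R}.

(* The supremum is taken in the extended reals, so that it is meaningful even
   when [X] is unbounded. *)
Definition Z_set (A : set X) :=
  closed A /\
  forall eps : R, 0 < eps ->
    exists f : X -> X,
      [/\ continuous f, range f `&` A = set0 &
          (ereal_sup [set (mdist (f x) x)%:E | x in [set: X]] < eps%:E)%E].

Definition sigma_Z_set (A : set X) :=
  exists F : nat -> set X, (forall i, Z_set (F i)) /\ A = \bigcup_i F i.

End Z_sets.

(* C(X): its metric and topology are those of [hausdorff_dist] below *)
Definition hyperspaceC (R : realType) (X : metricType R) : Type :=
  {A : set X | `[< continuum A >]}.

Section hyperspaceC.
Context {R : realType} {X : metricType R}.

HB.instance Definition _ := gen_eqMixin (hyperspaceC X).
HB.instance Definition _ := gen_choiceMixin (hyperspaceC X).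

Definition carrier (A : hyperspaceC X) : set X := sval A.

Definition dist_to_set (x : X) (A : set X) : R := inf [set mdist x a | a in A].

Definition excess (A B : set X) : R := sup [set dist_to_set a B | a in A].

Definition hausdorff_dist (A B : hyperspaceC X) : R :=
  Num.max (excess (carrier A) (carrier B)) (excess (carrier B) (carrier A)).

Lemma carrierP (A : hyperspaceC X) : continuum (carrier A).
Proof. by case: A => A /= /asboolP. Qed.

Lemma dist_to_set_ge0 x (A : set X) : 0 <= dist_to_set x A.
Proof.
have [->|/set0P A0] := eqVneq A set0; first by rewrite /dist_to_set image_set0 inf0.
apply: lb_le_inf; first by case: A0 => a Aa; exists (mdist x a), a.
by move=> _ [a _ <-]; exact: mdist_ge0.
Qed.

Lemma dist_to_set_le x a (A : set X) : A a -> dist_to_set x A <= mdist x a.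
Proof.
move=> Aa; apply: ge_inf; last by exists a.
by exists 0 => _ [b _ <-]; exact: mdist_ge0.
Qed.

Lemma dist_to_set_lt x (A : set X) (e : R) : A !=set0 ->
  dist_to_set x A < e -> exists2 a, A a & mdist x a < e.
Proof.
move=> [b Ab] /inf_lt[]; first by exists (mdist x b), b.
by move=> _ [a Aa <-] ae; exists a.
Qed.

Lemma dist_to_set_triangle x y (A : set X) : A !=set0 ->
  dist_to_set x A <= mdist x y + dist_to_set y A.
Proof.
move=> A0; apply/ler_addgt0Pl => e e0.
have [a Aa ya] : exists2 a, A a & mdist y a < dist_to_set y A + e.
  by apply: dist_to_set_lt => //; rewrite ltrDl.
rewrite (le_trans (dist_to_set_le x Aa))// (le_trans (metric_triangle x y a))//.
by rewrite addrCA lerD2l addrC ltW.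
Qed.

Lemma compact_mdist_bounded (A : set X) x : compact A ->
  exists M : R, forall a, A a -> mdist x a <= M.
Proof.
move=> /compact_near_coveringP/(_ nat \oo (fun i a => mdist x a < i%:R)) cA.
have /cA[N _ AN] : forall a, A a ->
    \forall b \near a & i \near \oo, mdist x b < i%:R.
  move=> a _; exists (ball a 1, [set i | mdist x a + 1 < i%:R]) => /=.
    by split; [exact: nbhsx_ballx|exact: nbhs_infty_gtr].
  move=> [b i] [/=]; rewrite ballEmdist/= => ab; apply: lt_trans.
  by rewrite (le_lt_trans (metric_triangle x a b))// ltrD2l.
by exists N%:R => a Aa; apply/ltW/AN => /=.
Qed.

Lemma excess_has_ubound (A B : set X) : compact A -> B !=set0 ->
  has_ubound [set dist_to_set a B | a in A].
Proof.
move=> cA [b Bb]; have [M AM] := compact_mdist_bounded b cA.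
exists M => _ [a Aa <-]; rewrite (le_trans (dist_to_set_le a Bb))//.
by rewrite metric_sym AM.
Qed.

Lemma dist_to_set_excess (A B : hyperspaceC X) a : carrier A a ->
  dist_to_set a (carrier B) <= excess (carrier A) (carrier B).
Proof.
move=> Aa; have [_ cA _] := carrierP A; have [B0 _ _] := carrierP B.
by apply: ub_le_sup; [exact: excess_has_ubound|exists a].
Qed.

Lemma excess_le (A : hyperspaceC X) (B : set X) M :
  (forall a, carrier A a -> dist_to_set a B <= M) -> excess (carrier A) B <= M.
Proof.
move=> AM; have [[a Aa] _ _] := carrierP A.
by apply: ge_sup; [exists (dist_to_set a B), a|move=> _ [c Ac <-]; exact: AM].
Qed.

Lemma dist_to_set0 (B : hyperspaceC X) x :
  dist_to_set x (carrier B) <= 0 -> carrier B x.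
Proof.
have [B0 cB _] := carrierP B => xB.
have clB : closed (carrier B) by apply: compact_closed cB; exact: metric_hausdorff.
apply: clB => U; rewrite -nbhs_ballE => -[e /= e0 eU].
have [b Bb xb] := dist_to_set_lt B0 (le_lt_trans xB e0).
by exists b; split => //; apply: eU; rewrite ballEmdist.
Qed.

Lemma excess_triangle (B A C : hyperspaceC X) :
  excess (carrier A) (carrier C) <=
  excess (carrier A) (carrier B) + excess (carrier B) (carrier C).
Proof.
apply: excess_le => a Aa; apply/ler_addgt0Pl => e e0.
have [B0 _ _] := carrierP B; have [C0 _ _] := carrierP C.
have [b Bb ab] : exists2 b, carrier B b &
    mdist a b < excess (carrier A) (carrier B) + e.
  apply: dist_to_set_lt => //.
  by rewrite (le_lt_trans (dist_to_set_excess B Aa))// ltrDl.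
rewrite (le_trans (dist_to_set_triangle a b C0))// addrA.
by rewrite lerD// ?(dist_to_set_excess C Bb)// addrC ltW.
Qed.

Lemma hausdorff_distxx (A : hyperspaceC X) : hausdorff_dist A A = 0.
Proof.
rewrite /hausdorff_dist maxxx; apply/eqP; rewrite eq_le; apply/andP; split.
  by apply: excess_le => a Aa; rewrite (le_trans (dist_to_set_le a Aa))// mdistxx.
have [[a Aa] _ _] := carrierP A.
exact: le_trans (dist_to_set_ge0 a _) (dist_to_set_excess A Aa).
Qed.

Lemma hausdorff_dist_positivity (A B : hyperspaceC X) :
  hausdorff_dist A B = 0 -> A = B.
Proof.
move=> AB0; have [AB BA] : excess (carrier A) (carrier B) <= 0 /\
    excess (carrier B) (carrier A) <= 0.
  by apply/andP; rewrite -ge_max -/(hausdorff_dist A B) AB0.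
apply: eq_sig_hprop; first by move=> S; exact: Prop_irrelevance.
by apply/seteqP; split=> x Ex; apply: dist_to_set0;
  [exact: le_trans (dist_to_set_excess B Ex) AB|
   exact: le_trans (dist_to_set_excess A Ex) BA].
Qed.

Lemma hausdorff_dist_sym (A B : hyperspaceC X) :
  hausdorff_dist A B = hausdorff_dist B A.
Proof. by rewrite /hausdorff_dist maxC. Qed.

Lemma hausdorff_dist_triangle (B A C : hyperspaceC X) :
  hausdorff_dist A C <= hausdorff_dist A B + hausdorff_dist B C.
Proof.
rewrite {1}/hausdorff_dist ge_max; apply/andP; split.
  by rewrite (le_trans (excess_triangle B A C))// lerD// le_max lexx.
rewrite (le_trans (excess_triangle B C A))// addrC.
by rewrite lerD// le_max lexx orbT.
Qed.

HB.instance Definition _ := isMetric.Build R (hyperspaceC X)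
  hausdorff_distxx hausdorff_dist_positivity hausdorff_dist_sym
  hausdorff_dist_triangle.

End hyperspaceC.

(* [Some n] is the finite dimension [n]; [None] is the infinite dimension, that
   of the Hilbert cube. *)
Definition dimension := option nat.

Definition at_least_dim (k : nat) (n : dimension) : bool :=
  if n is Some m then (k <= m)%N else true.

Definition cube_index (n : dimension) : Type :=
  if n is Some m then 'I_m else nat.

Definition index_rank (n : dimension) : cube_index n -> nat :=
  match n with Some m => @nat_of_ord m | None => id end.

Definition cube (R : realType) (n : dimension) : Type :=
  {ptws cube_index n -> (`[0, 1]%classic : set R)}.

Section cube.
Context {R : realType} {n : dimension}.
Implicit Types x y z : cube R n.

HB.instance Definition _ :=
  Uniform.copy (cube R n) {ptws cube_index n -> (`[0, 1]%classic : set R)}.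

Definition coord x (i : cube_index n) : R := \val (x i).

Definition weighted_diff x y (i : cube_index n) : R :=
  2^-1 ^+ index_rank i * `|coord x i - coord y i|.

(* A metric inducing the product topology (lemma [cube_entourage]), defined in
   all dimensions at once. *)
Definition cube_dist x y : R := sup (range (weighted_diff x y)).

Lemma coord01 x i : 0 <= coord x i <= 1.
Proof. by have := set_valP (x i); rewrite /coord /= in_itv. Qed.

Lemma weighted_diff_le1 x y i : weighted_diff x y i <= 1.
Proof.
have /andP[x0 x1] := coord01 x i; have /andP[y0 y1] := coord01 y i.
rewrite /weighted_diff -[leRHS]mulr1 ler_pM//.
- by rewrite exprn_ile1// invf_le1// ler1n.
- by rewrite ler_norml; apply/andP; split; lra.
Qed.

Lemma weighted_diff_has_ubound x y : has_ubound (range (weighted_diff x y)).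
Proof. by exists 1 => _ [i _ <-]; exact: weighted_diff_le1. Qed.

Lemma weighted_diff_ge0 x y i : 0 <= weighted_diff x y i.
Proof. by rewrite mulr_ge0// exprn_ge0. Qed.

Lemma weighted_diff_le x y i : weighted_diff x y i <= cube_dist x y.
Proof. by apply: ub_le_sup; [exact: weighted_diff_has_ubound|exists i]. Qed.

Lemma cube_dist_le x y e : 0 <= e ->
  (forall i, weighted_diff x y i <= e) -> cube_dist x y <= e.
Proof.
move=> e0 xye; rewrite /cube_dist.
have [->|/set0P E0] := eqVneq (range (weighted_diff x y)) set0.
  by rewrite sup0.
by apply: ge_sup => // _ [i _ <-]; exact: xye.
Qed.

Lemma cube_dist_ge0 x y : 0 <= cube_dist x y.
Proof.
rewrite /cube_dist.
have [->|/set0P[_ [i _ _]]] := eqVneq (range (weighted_diff x y)) set0.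
  by rewrite sup0.
exact: le_trans (weighted_diff_ge0 x y i) (weighted_diff_le x y i).
Qed.

Lemma cube_distxx x : cube_dist x x = 0.
Proof.
apply/eqP; rewrite eq_le cube_dist_ge0 andbT; apply: cube_dist_le => // i.
by rewrite /weighted_diff subrr normr0 mulr0.
Qed.

Lemma cube_dist_sym x y : cube_dist x y = cube_dist y x.
Proof.
rewrite /cube_dist (_ : weighted_diff x y = weighted_diff y x)//.
by apply/funext => i; rewrite /weighted_diff distrC.
Qed.

Lemma cube_dist_triangle y x z : cube_dist x z <= cube_dist x y + cube_dist y z.
Proof.
apply: cube_dist_le => [|i]; first by rewrite addr_ge0// cube_dist_ge0.
rewrite (le_trans _ (lerD (weighted_diff_le x y i) (weighted_diff_le y z i)))//.
by rewrite -mulrDr ler_wpM2l ?exprn_ge0 ?ler_distD.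
Qed.

Lemma coord_inj x y : coord x =1 coord y -> x = y.
Proof. by move=> xy; apply/funext => i; exact: eq_sig_hprop (xy i). Qed.

Lemma cube_dist_positivity x y : cube_dist x y = 0 -> x = y.
Proof.
move=> xy0; apply: coord_inj => i; apply/eqP; rewrite -subr_eq0 -normr_eq0.
have := weighted_diff_le x y i; rewrite xy0 /weighted_diff pmulr_rle0 ?exprn_gt0//.
by rewrite normr_le0 normr_eq0.
Qed.

Definition cube_ball x (e : R) : set (cube R n) := [set y | cube_dist x y < e].

Lemma cube_ball_center x (e : R) : 0 < e -> cube_ball x e x.
Proof. by rewrite /cube_ball /= cube_distxx. Qed.

Lemma cube_ball_sym x y (e : R) : cube_ball x e y -> cube_ball y e x.
Proof. by rewrite /cube_ball /= cube_dist_sym. Qed.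

Lemma cube_ball_triangle x y z (e1 e2 : R) :
  cube_ball x e1 y -> cube_ball y e2 z -> cube_ball x (e1 + e2) z.
Proof.
by rewrite /cube_ball /= => ? ?; rewrite (le_lt_trans (cube_dist_triangle y _ _))// ltrD.
Qed.

Lemma index_rank_inj : injective (@index_rank n).
Proof. by case: n => [m|] i j //=; exact: val_inj. Qed.

Lemma entourage_cube_ball_filter : Filter (entourage_ cube_ball).
Proof.
apply: filter_from_filter; first by exists 1 => /=.
move=> e1 e2 /= e10 e20; exists (Num.min e1 e2); first by rewrite /= lt_min e10.
by move=> [x y] /=; rewrite /cube_ball /= lt_min => /andP[].
Qed.

Lemma entourage_coord i (e : R) : 0 < e ->
  entourage [set xy : cube R n * cube R n | `|coord xy.1 i - coord xy.2 i| < e].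
Proof.
move=> e0; pose E := [set xy : cube R n * cube R n |
  `|coord xy.1 i - coord xy.2 i| < e].
have Ei : `[< @entourage (initial_topology (@proj _
    (fun=> (`[0, 1]%classic : set R)) i)) E >].
  apply/asboolP; exists [set xy | ball (\val xy.1) e (\val xy.2)] => //.
  exists [set xy | ball xy.1 e xy.2] => //.
  by rewrite -entourage_ballE; exists e.
exists E => //.
exact: (@finI_from1 _ _ _ _ (exist _ ((i : {classic cube_index n}), E) Ei)).
Qed.

Lemma entourage_coords N (e : R) : 0 < e ->
  entourage [set xy : cube R n * cube R n | forall i : cube_index n,
    (index_rank i < N)%N -> `|coord xy.1 i - coord xy.2 i| < e].
Proof.
move=> e0; elim: N => [|N IH]; first by apply: filterS entourageT.
have [[i iN]|nN] := pselect (exists i : cube_index n, index_rank i = N).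
  apply: filterS2 IH (entourage_coord i e0) => -[x y] /= xyN xyi j.
  rewrite ltnS leq_eqVlt => /orP[/eqP jN|]; last exact: xyN.
  by rewrite (_ : j = i)//; apply: index_rank_inj; rewrite jN.
apply: filterS IH => -[x y] /= xyN j; rewrite ltnS leq_eqVlt.
by move=> /orP[/eqP jN|]; [case: nN; exists j|exact: xyN].
Qed.

Lemma cube_entourage : entourage = entourage_ cube_ball.
Proof.
have FB := entourage_cube_ball_filter.
apply/seteqP; split=> E.
- move=> [_ [D _ <-] DE]; apply: filterS DE _.
  apply: filter_bigI => -[[i U] /= Ui] _.
  move/asboolP : Ui => [V [W]]; rewrite -entourage_ballE => -[e /= e0 eW WV VU].
  exists (2^-1 ^+ index_rank i * e) => /=; first by rewrite mulr_gt0// exprn_gt0.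
  move=> [x y] /=; rewrite /cube_ball /= => xy; apply/VU/WV/eW.
  have := le_lt_trans (weighted_diff_le x y i) xy.
  by rewrite /weighted_diff ltr_pM2l// exprn_gt0.
- move=> [e /= e0 eE].
  have e20 : 0 < e / 2 by rewrite divr_gt0.
  pose N := Num.bound (e / 2)^-1.
  have Ne : 2^-1 ^+ N < e / 2.
    by rewrite exprVn invf_plt ?posrE ?exprn_gt0//; exact: upper_nthrootP.
  apply: filterS (entourage_coords N e20) => -[x y] /= xyN; apply: eE => /=.
  rewrite /cube_ball/= (@le_lt_trans _ _ (e / 2)) ?gtr_pMr ?invf_lt1 ?ltr1n//.
  apply: cube_dist_le => [|i]; first exact: ltW.
  have w0 : 0 <= (2^-1 : R) ^+ index_rank i by rewrite exprn_ge0.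
  have w1 : (2^-1 : R) ^+ index_rank i <= 1 by rewrite exprn_ile1// invf_le1// ler1n.
  rewrite /weighted_diff; have [iN|Ni] := ltnP (index_rank i) N.
    by rewrite (le_trans _ (ltW (xyN i iN)))// ler_piMl.
  have wN : (2^-1 : R) ^+ index_rank i <= 2^-1 ^+ N.
    by rewrite ler_wiXn2l// invf_le1// ler1n.
  rewrite (le_trans _ (ltW Ne))// (le_trans _ wN)// ler_piMr//.
  have /andP[x0 x1] := coord01 x i; have /andP[y0 y1] := coord01 y i.
  by rewrite ler_norml; apply/andP; split; lra.
Qed.

HB.instance Definition _ := Uniform_isPseudoMetric.Build R (cube R n)
  cube_ball_center cube_ball_sym cube_ball_triangle cube_entourage.

HB.instance Definition _ := PseudoMetric_isMetric.Build R (cube R n)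
  cube_dist_ge0 cube_dist_positivity (fun _ _ => erefl).

End cube.

Section families.
Variables (R : realType) (n : dimension).

Definition decomposable_continua : set (hyperspaceC (cube R n)) :=
  [set A | decomposable (carrier A)].

Definition wilder_continua : set (hyperspaceC (cube R n)) :=
  [set A | wilder (carrier A)].

Definition cw_wilder_continua : set (hyperspaceC (cube R n)) :=
  [set A | cw_wilder (carrier A)].

Definition arcwise_connected_continua : set (hyperspaceC (cube R n)) :=
  [set A | nondegenerate (carrier A) /\ arcwise_connected R (carrier A)].

Definition hereditarily_arcwise_connected_continua : set (hyperspaceC (cube R n)) :=
  [set A | nondegenerate (carrier A) /\
           hereditarily_arcwise_connected R (carrier A)].

End families.

Arguments decomposable_continua : clear implicits.
Arguments wilder_continua : clear implicits.
Arguments cw_wilder_continua : clear implicits.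
Arguments arcwise_connected_continua : clear implicits.
Arguments hereditarily_arcwise_connected_continua : clear implicits.

(* Main.v *)
Require Import Defs.
From HB Require Import structures.
From mathcomp Require Import all_boot all_order all_algebra.
From mathcomp Require Import all_classical all_reals all_analysis.
From mathcomp Require Import zify ring lra.

Set Implicit Arguments.
Unset Strict Implicit.
Unset Printing Implicit Defensive.

Import Order.TTheory GRing.Theory Num.Theory.
Import numFieldTopology.Exports numFieldNormedType.Exports.

Local Open Scope classical_set_scope.
Local Open Scope ring_scope.

(** Two arguments carry the proof.

    Decomposability.  A proper subcontinuum with nonempty interior makes a
    continuum [A] decomposable ([decomposable_of_interior]).  If [A] is
    indecomposable, the composant of a point [x] is therefore a countable union
    of closed sets with empty interior, and a Baire argument leaves two points
    [y], [z] outside it: a subcontinuum of [A] containing [x] and one of [y],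
    [z] is the whole of [A] ([exists_two_irreducible_points]).  This
    contradicts the Wilder property at [x], [y], [z].  If [A] is arcwise
    connected, an arc from [x] to [y] is the whole of [A], and arcs are
    decomposable.

    The sigma-Z property.  At scale [e], the continuum [A] is decomposable when
    it is the union of two subcontinua over both of which it has excess at least
    [e].  These sets are closed because the hyperspace is
    compact, and their union over [e = 1, 1/2, 1/3, ...] is the set of
    decomposable continua ([decomposableE]).  It remains to push all continua
    off such a set by a small continuous map ([stack]).

    Fix a fine grid of the cube.  A continuum [K] is approximated by a graph on
    the grid vertices near [K]; its edges grow and shrink with the distances
    from [K] to the vertices, which makes the approximation continuous
    ([grown_continuous]).  With [v] the number of vertices, place [2v + 1]
    copies of this graph, its levels, next to each other, each translated a
    little along the diagonal of the cube.  The levels are disjoint: on an edge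
    at most one coordinate leaves the grid at a time, so among three coordinates
    a common point of two levels would have one on both translated grids, which
    are disjoint ([grid_point_height]); this is where dimension 3 enters.  Consecutive levels
    are joined by short diagonal connectors over vertices.  To the gap between
    two levels a vertex is assigned.  When this vertex is close to [K], its
    connector is the only complete one in the gap; when it is far from [K], other
    connectors are complete and keep the stack connected.  A connected subset of
    the stack that meets both sides of a gap with close vertex must then pass
    over this vertex ([stack_crossing]).  Every vertex is assigned to a gap in the
    lower half and to a gap in the upper half.  Hence a subcontinuum that
    contains a point of two of the bottom, middle and top levels comes close to
    all points of [K], thus to all points of the stack.  If the stack is the
    union of two subcontinua, one of them contains two of three points chosen on
    these levels, so it has small excess
    ([stack_not_coarsely_decomposable]). *)

(** * Subcontinua of indecomposable continua *)

Section indecomposable.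
Context {R : realType} {X : metricType R}.
Implicit Types (A K O : set X) (x y : X).

Lemma closed_mdist_le (x : X) (r : R) : closed [set y | mdist x y <= r].
Proof.
move=> y yr /=; apply/ler_addgt0Pl => e e0.
have [z [/= xz]] := yr _ (nbhsx_ballx y e e0).
rewrite ballEmdist/= metric_sym => zy.
by rewrite (le_trans (metric_triangle x z y))// addrC lerD// ltW.
Qed.

Lemma open_mdist_lt (x : X) (r : R) : open [set y | mdist x y < r].
Proof.
rewrite openE => y /= xy; rewrite /interior -nbhs_ballE.
exists (r - mdist x y) => /=; first by rewrite subr_gt0.
move=> z; rewrite ballEmdist/= ltrBrDl; exact: le_lt_trans (metric_triangle x y z).
Qed.

Lemma open_mdist (O : set X) x : open O -> O x ->
  exists2 r : R, 0 < r & [set y | mdist x y <= r] `<=` O.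
Proof.
move=> oO Ox; have : nbhs x O by exact: open_nbhs_nbhs.
rewrite -nbhs_ballE => -[r /= r0 rO]; exists (r / 2); first by rewrite divr_gt0.
move=> y /= xy; apply: rO; rewrite ballEmdist/= (le_lt_trans xy)//.
by rewrite ltr_pdivrMr// ltr_pMr// ltr1n.
Qed.

Lemma continuum_closed K : continuum K -> closed K.
Proof. by case=> _ cK _; apply: compact_closed cK; exact: metric_hausdorff. Qed.

Lemma continuum1 (x : X) : continuum [set x].
Proof. by split; [exists x|exact: compact_set1|exact: connected1]. Qed.

(** A splitting of [K `|` E0] would put [K] on one side.  The other side, being
    part of [E0], is separated from [E1] too, so it would split off from the
    whole of [A]. *)
Lemma connected_setU_piece A K (E0 E1 : set X) :
  connected A -> connected K -> K !=set0 -> A = K `|` (E0 `|` E1) ->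
  separated E0 E1 -> E1 !=set0 -> connected (K `|` E0).
Proof.
move=> cA cK K0 AE sE E10; apply/connectedP => F [F0 KF sF].
wlog KF0 : F F0 KF sF / K `<=` F false.
  move=> G; have [] := connected_subset sF _ cK.
  - by rewrite -KF; left.
  - exact: G.
  - move=> KF1; apply: (G (F \o negb)) => //=; last by rewrite separatedC.
    by rewrite KF setUC.
have FE : F true `<=` E0.
  move=> x Fx; have : (K `|` E0) x by rewrite KF; right.
  case=> // Kx; exfalso; have := separated_disjoint sF.
  by move/seteqP=> [/(_ x) + _]; apply; split => //; exact: KF0.
case: sF => sF1 sF2; case: sE => sE1 sE2.
move/connectedP: cA => /(_ (fun b => if b then F true else F false `|` E1)).
apply; split.
- by case; [exact: F0|case: E10 => x; exists x; right].
- by rewrite /= AE setUA KF setUAC.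
- split.
  + rewrite closureU setIUl sF1 set0U; apply/seteqP; split=> // x [cx /FE Ex].
    by rewrite -sE2; split.
  + rewrite setIUl sF2 set0U; apply/seteqP; split=> // x [Ex cx].
    by rewrite -sE1; split => //; exact: closureS FE _ cx.
Qed.


(** If [A `\` K] is connected, its closure is a proper subcontinuum, as it
    misses the interior of [K], and it covers [A] together with [K].
    Otherwise [A `\` K] splits into two pieces, and [K] with either piece is a
    proper subcontinuum. *)
Lemma decomposable_of_interior A K O : continuum A -> continuum K ->
  K `<=` A -> K <> A -> open O -> A `&` O !=set0 -> A `&` O `<=` K ->
  decomposable A.
Proof.
move=> cA cK KA KneA oO AO0 AOK.
have [_ compA conA] := cA; have clA := continuum_closed cA.
have clK := continuum_closed cK; have [K0 _ conK] := cK.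
have AD : A = K `|` (A `\` K) by rewrite setDUK.
have D0 : A `\` K !=set0.
  apply/set0P/negP => /eqP AK; apply: KneA; apply/seteqP; split=> //.
  by rewrite -setD_eq0.
have [conD|] := pselect (connected (A `\` K)).
  have cDA : closure (A `\` K) `<=` A.
    by rewrite [X in _ `<=` X]((closure_id A).1 clA); apply: closureS => x [].
  exists K, (closure (A `\` K)); split=> //.
  - split; first by case: D0 => x /subset_closure; exists x.
      by apply: subclosed_compact cDA => //; exact: closed_closure.
    exact: connected_closure.
  - by rewrite properEneq; split => //; exact/eqP.
  - rewrite properEneq; split=> //; apply/eqP => DA.
    case: AO0 => x [Ax Ox]; have : closure (A `\` K) x by rewrite DA.
    move=> /(_ O (open_nbhs_nbhs (conj oO Ox)))[y [[Ay nKy] Oy]].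
    by apply: nKy; exact: AOK.
  - apply/seteqP; split=> [x Ax|x [/KA|/cDA]] //.
    by have [|nKx] := pselect (K x); [left|right; exact: subset_closure].
move=> /connectedPn[E [E0 DE sE]].
have ADE : A = K `|` (E false `|` E true) by rewrite -DE.
have EA b : E b `<=` A by move=> x Ex; rewrite ADE; right; case: b Ex; [right|left].
have EK b : E b `&` K = set0.
  apply/seteqP; split=> // x [Ex Kx].
  have : (A `\` K) x by rewrite DE; case: b Ex; [right|left].
  by case.
have KE b : continuum (K `|` E b).
  have sEb : separated (E b) (E (~~ b)) by case: b => //=; rewrite separatedC.
  have AEb : A = K `|` (E b `|` E (~~ b)) by case: b {sEb} => //=; rewrite (setUC (E true)).
  split; first by case: K0 => x; exists x; left.
    apply: (subclosed_compact _ compA); last first.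
      by rewrite subUset; split=> //; exact: EA.
    move=> x; rewrite closureU -((closure_id K).1 clK) => -[Kx|cx]; first by left.
    have : A x by rewrite ((closure_id A).1 clA); exact: closureS (@EA b) _ cx.
    rewrite AEb => -[Kx|[Ex|Ex]]; [by left|by right|exfalso].
    by case: sEb => /seteqP[/(_ x) + _] _; apply.
  exact: (connected_setU_piece conA conK K0 AEb sEb (E0 _)).
have prop b : K `|` E b `<` A.
  rewrite properEneq; split; last by rewrite subUset; split=> //; exact: EA.
  apply/eqP => KEA; have [x Ex] := E0 (~~ b).
  have : (K `|` E b) x by rewrite KEA; exact: EA Ex.
  case=> [Kx|Ebx].
    by have /seteqP[/(_ x) + _] := EK (~~ b); apply.
  have /seteqP[/(_ x) + _] := separated_disjoint sE; apply.
  by case: b {KEA} Ex Ebx.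
exists (K `|` E false), (K `|` E true); split => //.
by rewrite setUACA setUid.
Qed.


(** The point serves only to give [X] the structure of a pointed space. *)
Lemma second_countable_of_compact (x : X) :
  compact [set: X] -> @second_countable X.
Proof.
move=> cX.
pose PX : pseudoPMetricType R :=
  HB.pack (X : Type) (isPointed.Build X x) (Metric.on X).
exact: (@compact_second_countable R PX cX).
Qed.

(** A proper subcontinuum containing [x] misses some basic open set [U] that
    meets [A], so it lies in the component of [x] in [A `\` U].  These
    components are countably many, and each is a subcontinuum with empty interior
    in [A]; a nested sequence of balls centred in [A] avoids them one after
    another, and by compactness it closes in on the required point. *)
Lemma exists_irreducible_point A x O : compact [set: X] ->
  continuum A -> ~ decomposable A -> A x -> open O -> A `&` O !=set0 ->
  exists2 y, (A `&` O) y &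
    forall K, continuum K -> K `<=` A -> K x -> K y -> K = A.
Proof.
move=> cX cA ndA Ax oO [y0 [Ay0 Oy0]].
have [_ compA _] := cA; have clA := continuum_closed cA.
have [B /countable_injP[enc enc_inj] [Bopen Bbasis]] :=
  second_countable_of_compact x cX.
pose comp U := connected_component (A `\` U) x.
pose cball (b : X * R) := [set y | mdist b.1 y <= b.2].
pose good (b : X * R) := A b.1 /\ 0 < b.2.
have good_center b : good b -> (A `&` cball b) b.1.
  by move=> [Ab b0]; split => //; rewrite /cball /= mdistxx ltW.
have compP U : B U -> ~ U x -> continuum (comp U).
  move=> BU nUx; split; last exact: component_connected.
    by exists x; exact: connected_component_refl.
  apply: subclosed_compact (_ : compact A) _ => //.
    apply: component_closed; rewrite setDE; apply: closedI => //.
    by apply: open_closedC; exact: Bopen.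
  by move=> y /connected_component_sub[].
have step (nb : nat * (X * R)) : exists b', good nb.2 -> [/\ good b',
    cball b' `<=` cball nb.2 &
    forall U, B U -> enc U = nb.1 -> ~ U x -> A `&` U !=set0 ->
      cball b' `&` comp U = set0].
  case: nb => n b /=; have [gb|] := pselect (good b); last by exists b.
  have [[U [BU UN nUx AU]]|noU] := pselect (exists U,
      [/\ B U, enc U = n, ~ U x & A `&` U !=set0]); last first.
    by exists b => _; split => // U BU UN nUx AU; case: noU; exists U.
  pose V := [set y | mdist b.1 y < b.2].
  have VO : open V by exact: open_mdist_lt.
  (* the component has no interior in [A], so it does not fill the ball *)
  have [y [[Ay Vy] ny]] : exists y, (A `&` V) y /\ ~ comp U y.
    apply: contrapT => noy; apply: ndA.
    apply: (@decomposable_of_interior A (comp U) V) => //.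
    - exact: compP.
    - by move=> z /connected_component_sub[].
    - case: AU => z [Az Uz] E; have : comp U z by rewrite E.
      by move=> /connected_component_sub[].
    - by exists b.1; rewrite /V /= mdistxx; case: gb.
    - by move=> z AVz; apply: contrapT => nz; apply: noy; exists z.
  have [r r0 rV] : exists2 r : R, 0 < r &
      [set z | mdist y z <= r] `<=` V `&` ~` comp U.
    apply: open_mdist => //; apply: openI => //; apply: closed_openC.
    by apply: continuum_closed; exact: compP.
  exists (y, r) => _; split => //.
    by move=> z /rV[/ltW].
  move=> W BW Wn nWx AW; have -> : W = U.
    by apply: enc_inj; rewrite ?inE// Wn.
  by apply/seteqP; split=> // z [/rV[]].
have [next nextP] := choice step.
have [r0 r00 r0O] := open_mdist oO Oy0.
pose fix b n := if n is p.+1 then next (p, b p) else (y0, r0).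
have gb n : good (b n) by elim: n => [//|n gn]; case: (nextP (n, b n)).
have bS n : cball (b n.+1) `<=` cball (b n) by case: (nextP (n, b n) (gb n)).
have bD n k : cball (b (n + k)%N) `<=` cball (b n).
  by elim: k => [|k IH]; rewrite ?addn0// addnS; exact: subset_trans (bS _) IH.
pose F := filter_from [set: nat] (fun n => A `&` cball (b n)).
have FF : ProperFilter F.
  apply: filter_from_proper; last first.
    by move=> n _; exists (b n).1; exact: good_center.
  apply: filter_from_filter; first by exists 0%N.
  move=> i j _ _; exists (i + j)%N => // z [Az bz]; split; split => //.
    exact: bD bz.
  by apply: (bD j i); rewrite addnC.
have [y [Ay cly]] : A `&` cluster F !=set0.
  by apply: compA; exists 0%N => // z [].
have yb n : cball (b n) y.
  apply: closed_mdist_le => W Wy.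
  have FAb : F (A `&` cball (b n)) by exists n.
  by have [z [[_ bz] Wz]] := cly _ _ FAb Wy; exists z.
exists y; first by split => //; apply: r0O; exact: (yb 0%N).
move=> K cK KA Kx Ky; apply: contrapT => KneA.
have [z Az nKz] : exists2 z, A z & ~ K z.
  apply: contrapT => noz; apply: KneA; apply/seteqP; split=> // z Az.
  by apply: contrapT => nKz; apply: noz; exists z.
have : nbhs z (~` K).
  apply: open_nbhs_nbhs; split=> //; apply: closed_openC.
  exact: continuum_closed.
move=> /Bbasis[U [BU Uz] UK].
have nUx : ~ U x by move=> /UK.
have [_ _ /(_ U BU erefl nUx)] := nextP (enc U, b (enc U)) (gb _).
have AU : A `&` U !=set0 by exists z.
move=> /(_ AU)/seteqP[/(_ y) + _]; apply; split; first exact: (yb (enc U).+1).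
exists K => //; split => //; last by case: cK.
by move=> w Kw; split; [exact: KA|move=> /UK].
Qed.

(** The complement of the composant of [x] is dense in [A], so it has a point
    other than a given one. *)
Lemma exists_two_irreducible_points A x : compact [set: X] ->
  continuum A -> ~ decomposable A -> Defs.nondegenerate A -> A x ->
  exists y z, [/\ A y, A z & y <> z] /\
    forall K, continuum K -> K `<=` A -> K x -> K y \/ K z -> K = A.
Proof.
move=> cX cA ndA [a [b [Aa Ab ab]]] Ax.
have [|y [Ay _] yP] := exists_irreducible_point cX cA ndA Ax (@openT X).
  by exists x.
have oy : open (~` [set y]).
  by apply: closed_openC; apply: continuum_closed; exact: continuum1.
have [|z [Az zy] zP] := exists_irreducible_point cX cA ndA Ax oy.
  have [ay|ay] := pselect (a = y); last by exists a; split.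
  by exists b; split=> //= yb; apply: ab; rewrite ay yb.
exists y, z; split; first by split => // /esym.
by move=> K cK KA Kx [Ky|Kz]; [exact: yP|exact: zP].
Qed.

Lemma nondegenerate_neq_set1 (x : X) A : Defs.nondegenerate A -> [set x] <> A.
Proof. by move=> [a [b [Aa Ab ab]]] E; apply: ab; move: Aa Ab; rewrite -E => -> ->. Qed.

Lemma wilder_decomposable A : compact [set: X] -> continuum A ->
  wilder A -> decomposable A.
Proof.
move=> cX cA [[x [y [z [[Ax Ay Az] [xy yz xz]]]]] W]; apply: contrapT => ndA.
have ndegA : Defs.nondegenerate A by exists x, y.
have [p [q [[Ap Aq pq] pqP]]] :=
  exists_two_irreducible_points cX cA ndA ndegA Ax.
have ne w : w = p \/ w = q -> x <> w.
  move=> wpq xw; apply: (@nondegenerate_neq_set1 x A ndegA).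
  apply: pqP => //; [exact: continuum1|by move=> _ ->|].
  by case: wpq => <-; [left|right].
have [K [KA cK Kx Kpq]] :=
  W x p q Ax Ap Aq (ne _ (or_introl erefl)) pq (ne _ (or_intror erefl)).
have KE : K = A by apply: pqP => //; case: Kpq => -[]; [left|right].
by case: Kpq => -[_]; apply; rewrite KE.
Qed.

(** A one-point continuum is enclosed by exactly the continua containing its
    point, so the condition on subcontinua specializes to that on points. *)
Lemma cw_wilder_wilder A : cw_wilder A -> wilder A.
Proof.
move=> [A3 W]; split=> // x y z Ax Ay Az xy yz xz.
have disj a b : a <> b -> [set a] `&` [set b] = set0 :> set X.
  by move=> ab; apply/seteqP; split=> // w [/= -> ab']; exact: ab.
have sub a : A a -> [set a] `<=` A by move=> Aa _ ->.
have [L [LA cL xL LE]] := W [set x] [set y] [set z]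
  (And3 (continuum1 _) (continuum1 _) (continuum1 _))
  (And3 (sub _ Ax) (sub _ Ay) (sub _ Az))
  (And3 (disj _ _ xy) (disj _ _ yz) (disj _ _ xz)).
exists L; split=> //; first exact: xL.
have out a : [set a] `&` L = set0 -> ~ L a.
  by move=> /seteqP[/(_ a) + _] La; apply.
by case: LE => -[yL /out nz]; [left|right]; split=> //; exact: yL.
Qed.

Lemma is_arc_continuum x y J : is_arc R x y J -> continuum J.
Proof.
move=> [f [g [cf _ <- _ _]]].
split; first by exists (f 0), 0 => //=; rewrite in_itv/= lexx ler01.
  by apply: continuous_compact cf _; exact: segment_compact.
by apply: connected_continuous_connected cf; exact: segment_connected.
Qed.

(** The two halves of the arc are proper since [f] is injective. *)
Lemma arc_decomposable x y A : x <> y -> is_arc R x y A -> decomposable A.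
Proof.
move=> xy [f [g [cf _ fA fg [f0 f1]]]].
have inj s t : 0 <= s <= 1 -> 0 <= t <= 1 -> f s = f t -> s = t.
  move=> s01 t01 fst; have := fg s; rewrite in_itv/= fst => /(_ s01) <-.
  by rewrite fg// in_itv.
have sub a b : 0 <= a -> b <= 1 -> `[a, b]%classic `<=` (`[0, 1]%classic : set R).
  move=> a0 b1 t /=; rewrite !in_itv/= => /andP[at_ tb].
  by rewrite (le_trans a0)//= (le_trans tb).
have cimage a b : 0 <= a -> a <= b -> b <= 1 -> continuum (f @` `[a, b]).
  move=> a0 ab b1.
  have cfab : {within `[a, b], continuous f} by apply: continuous_subspaceW cf; exact: sub.
  split; first by exists (f a), a => //=; rewrite in_itv/= lexx.
    by apply: continuous_compact cfab _; exact: segment_compact.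
  by apply: connected_continuous_connected cfab; exact: segment_connected.
have h0 : 0 <= 2^-1 :> R by rewrite invr_ge0.
have h1 : 2^-1 <= 1 :> R by rewrite invf_le1// ler1n.
exists (f @` `[0, 2^-1]), (f @` `[2^-1, 1]); split.
- exact: cimage.
- exact: cimage.
- rewrite properEneq; split; last by rewrite -fA; apply: image_subset; exact: sub.
  apply/eqP => E; have : A (f 1) by rewrite -fA; exists 1 => //=; rewrite in_itv/= ler01 lexx.
  rewrite -E => -[t /=]; rewrite in_itv/= => /andP[t0 t1] ft.
  have tE : t = 1 by apply: inj => //; [lra|lra].
  by move: t1; rewrite tE; lra.
- rewrite properEneq; split; last by rewrite -fA; apply: image_subset; exact: sub.
  apply/eqP => E; have : A (f 0) by rewrite -fA; exists 0 => //=; rewrite in_itv/= ler01 lexx.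
  rewrite -E => -[t /=]; rewrite in_itv/= => /andP[t0 t1] ft.
  have tE : t = 0 by apply: inj => //; [lra|lra].
  by move: t0; rewrite tE; lra.
- rewrite -fA -image_setU; congr (f @` _); apply/seteqP; split=> t /=; rewrite !in_itv/=.
    by move=> /andP[t0 t1]; case: (leP t 2^-1) => th; [left; rewrite t0|right; rewrite ltW].
  by case=> /andP[t0 t1]; apply/andP; split => //; [exact: le_trans t1 h1|exact: le_trans h0 t0].
Qed.

(** An arc joining [x] to a point outside its composant is the whole of [A]. *)
Lemma arcwise_connected_decomposable A : compact [set: X] -> continuum A ->
  Defs.nondegenerate A -> arcwise_connected R A -> decomposable A.
Proof.
move=> cX cA ndegA arcA; apply: contrapT => ndA.
have [x [_ [Ax _ _]]] := ndegA.
have [p [q [[Ap Aq pq] pqP]]] :=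
  exists_two_irreducible_points cX cA ndA ndegA Ax.
have xp : x <> p.
  move=> xp; apply: (@nondegenerate_neq_set1 x A ndegA).
  apply: pqP => //; [exact: continuum1|by move=> _ ->|].
  by left; rewrite -xp.
have [J arcJ JA] := arcA x p Ax Ap xp.
apply: ndA; rewrite -(pqP J) //; [exact: arc_decomposable arcJ| | |].
- exact: is_arc_continuum arcJ.
- by case: arcJ => f [g [_ _ <- _ [<- _]]]; exists 0 => //=; rewrite in_itv/= ler01 lexx.
- by left; case: arcJ => f [g [_ _ <- _ [_ <-]]]; exists 1 => //=; rewrite in_itv/= ler01 lexx.
Qed.

End indecomposable.

(** * Compactness of the hyperspace of subcontinua *)

Section hyperspace.
Context {R : realType} {X : metricType R}.
Implicit Types (A B H M : hyperspaceC X) (x y : X).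

Lemma mdist_hyperspaceE A B : mdist A B = hausdorff_dist A B.
Proof. by []. Qed.

Lemma excess_le_mdist A B : excess (carrier A) (carrier B) <= mdist A B.
Proof. by rewrite mdist_hyperspaceE /hausdorff_dist le_max lexx. Qed.

Lemma dist_to_set_le_mdist A B a : carrier A a ->
  dist_to_set a (carrier B) <= mdist A B.
Proof.
by move=> Aa; exact: le_trans (dist_to_set_excess B Aa) (excess_le_mdist A B).
Qed.

Lemma mdist_le_excess A B r :
  (forall a, carrier A a -> dist_to_set a (carrier B) <= r) ->
  (forall b, carrier B b -> dist_to_set b (carrier A) <= r) -> mdist A B <= r.
Proof.
move=> AB BA; rewrite mdist_hyperspaceE /hausdorff_dist ge_max.
by rewrite !excess_le.
Qed.

Lemma compact_closed_gap (C D : set X) : compact C -> closed D ->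
  C `&` D = set0 ->
  exists2 e : R, 0 < e & forall c d, C c -> D d -> e <= mdist c d.
Proof.
move=> /compact_near_coveringP cC cD CD.
have : \forall e \near (0 : R)^'+, C `<=` (fun c => forall d, D d -> e <= mdist c d).
  apply: cC => c Cc.
  have [r r0 rD] : exists2 r : R, 0 < r & [set y | mdist c y <= r] `<=` ~` D.
    apply: open_mdist; first exact: closed_openC.
    by move=> Dc; have /seteqP[/(_ c) + _] := CD; apply.
  have r20 : 0 < r / 2 by rewrite divr_gt0.
  exists ([set c' | mdist c c' < r / 2], [set e | e < r / 2]).
    split => /=; last exact: nbhs_right_lt.
    by apply: open_nbhs_nbhs; split; [exact: open_mdist_lt|rewrite /= mdistxx].
  move=> [c' e] [/= cc' er] d Dd; rewrite leNgt; apply/negP => c'd.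
  apply: (rD d) Dd => /=; rewrite (le_trans (metric_triangle c c' d))//.
  by rewrite (splitr r) ltW// ltrD// (lt_trans c'd).
move=> He; near (0 : R)^'+ => e; exists e => // c d Cc.
by have : C `<=` (fun c => forall d, D d -> e <= mdist c d); [near: e|apply].
Unshelve. all: by end_near. Qed.

(** The limit of an ultrafilter of continua consists of the points that are
    arbitrarily close to almost all of them. *)
Section ultralimit.
Variable F : set_system (hyperspaceC X).
Context {FF : UltraFilter F}.
Hypothesis cX : compact [set: X].

Let PF : ProperFilter F := @ultra_proper _ _ FF.

Let lim_set : set X := [set x |
  forall e : R, 0 < e -> F [set B | dist_to_set x (carrier B) < e]].

Let lim_closed : closed lim_set.
Proof.
move=> x clx e e0; have e20 : 0 < e / 2 by rewrite divr_gt0.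
have [y [Hy]] := clx _ (nbhsx_ballx x _ e20); rewrite ballEmdist/= => xy.
apply: filterS (Hy _ e20) => B /= yB; have [B0 _ _] := carrierP B.
by rewrite (le_lt_trans (dist_to_set_triangle x y B0))// (splitr e) ltrD.
Qed.

Let lim_compact : compact lim_set.
Proof. exact: subclosed_compact lim_closed cX _. Qed.

(** By compactness this can be checked near one point [x] at a time: either
    [x] belongs to the limit, or, the filter being an ultrafilter, almost
    all continua avoid a neighborhood of [x]. *)
Let near_lim e : 0 < e ->
  \forall B \near F, forall b, carrier B b -> exists2 x, lim_set x & mdist b x < e.
Proof.
move=> e0; move/compact_near_coveringP : cX => nc.
have := nc _ F (fun B b => carrier B b -> exists2 x, lim_set x & mdist b x < e) _.
move=> /(_ PF) K; apply: filterS (K _) => [B BK b|x _].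
  exact: BK.
have [Hx|nHx] := pselect (lim_set x).
  exists ([set y | mdist x y < e], setT).
    split => /=; last exact: filterT.
    by apply: open_nbhs_nbhs; split; [exact: open_mdist_lt|rewrite /= mdistxx].
  by move=> [b B] [/= xb _] _; exists x => //; rewrite metric_sym.
have [r [r0 nFr]] : exists r : R, 0 < r /\
    ~ F [set B | dist_to_set x (carrier B) < r].
  apply: contrapT => nr; apply: nHx => r r0.
  by apply: contrapT => nF; apply: nr; exists r.
have [//|Fr] := in_ultra_setVsetC [set B | dist_to_set x (carrier B) < r] FF.
exists ([set y | mdist x y < r], ~` [set B | dist_to_set x (carrier B) < r]).
  split => //=.
  by apply: open_nbhs_nbhs; split; [exact: open_mdist_lt|rewrite /= mdistxx].
move=> [b B] [/= xb nxB] Bb; exfalso; apply: nxB.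
exact: le_lt_trans (dist_to_set_le x Bb) xb.
Qed.

Let lim_near e : 0 < e ->
  \forall B \near F, forall x, lim_set x -> dist_to_set x (carrier B) < e.
Proof.
move=> e0; have e20 : 0 < e / 2 by rewrite divr_gt0.
move/compact_near_coveringP : lim_compact => nc.
apply: (nc _ F (fun B x => dist_to_set x (carrier B) < e) PF) => x Hx.
exists ([set y | mdist x y < e / 2], [set B | dist_to_set x (carrier B) < e / 2]).
  split => /=; last exact: Hx.
  by apply: open_nbhs_nbhs; split; [exact: open_mdist_lt|rewrite /= mdistxx].
move=> [y B] [/= xy xB]; have [B0 _ _] := carrierP B.
rewrite (le_lt_trans (dist_to_set_triangle y x B0))// (splitr e) ltrD//.
by rewrite metric_sym.
Qed.

(** A splitting of the limit would yield two disjoint open sets that cover a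
    continuum close to the limit and both meet it. *)
Let lim_connected : connected lim_set.
Proof.
apply/connectedP => E [E0 HE sE].
have [sE1 sE2] := sE.
have EH b : E b `<=` lim_set by move=> x Ex; rewrite HE; case: b Ex; [right|left].
have clE b : closed (E b).
  move=> x cx; have : lim_set x.
    by rewrite ((closure_id lim_set).1 lim_closed); exact: closureS (@EH b) _ cx.
  rewrite HE; case: b cx => cx [] // Ex.
    by have /seteqP[/(_ x) + _] := sE2; case.
  by have /seteqP[/(_ x) + _] := sE1; case.
have cE0 : compact (E false).
  by apply: subclosed_compact cX _.
have [r r0 rE] := compact_closed_gap cE0 (clE true) (separated_disjoint sE).
have r20 : 0 < r / 2 by rewrite divr_gt0.
pose U b := \bigcup_(x in E b) [set y | mdist x y < r / 2].
have oU b : open (U b) by apply: bigcup_open => x _; exact: open_mdist_lt.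
have dU : U false `&` U true = set0.
  apply/seteqP; split=> // y [[x0 Ex0 /= xy0] [x1 Ex1 /= xy1]].
  have := rE _ _ Ex0 Ex1; rewrite leNgt => /negP; apply.
  rewrite (le_lt_trans (metric_triangle x0 y x1))// (splitr r) ltrD//.
  by rewrite metric_sym.
have [B [BU UB]] := filter_ex (filterI (near_lim r20) (lim_near r20)).
have BUb b : carrier B `&` U b !=set0.
  have [x Ex] := E0 b; have [B0 _ _] := carrierP B.
  have [y By xy] := dist_to_set_lt B0 (UB _ (EH _ _ Ex)).
  by exists y; split => //; exists x.
have BUU : carrier B `<=` U false `|` U true.
  move=> b /BU[x]; rewrite HE metric_sym => -[Ex|Ex] bx; [left|right]; by exists x; rewrite //= metric_sym.
have [_ _ conB] := carrierP B.
have BE : carrier B `&` U false = carrier B.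
  apply: conB; [exact: BUb|by exists (U false)|].
  exists (~` U true); first exact: open_closedC.
  apply/seteqP; split=> x [Bx Ux]; split => //.
    by move=> U1x; have /seteqP[/(_ x) + _] := dU; apply.
  by have [] := BUU _ Bx.
have [x [Bx Ux]] := BUb true; move: Bx; rewrite -BE => -[_ U0x].
by have /seteqP[/(_ x) + _] := dU; apply.
Qed.

Lemma hyperspace_ultra_cvg : exists A, F --> A.
Proof.
have cH : continuum lim_set.
  split; [|exact: lim_compact|exact: lim_connected].
  have [B BH] := filter_ex (near_lim (@ltr01 R)).
  by have [[b Bb] _ _] := carrierP B; have [x Hx _] := BH b Bb; exists x.
pose A : hyperspaceC X := exist _ lim_set (asboolT cH).
exists A; apply/metricType_numDomainType.fcvgrPdist_lt => e e0.
have e20 : 0 < e / 2 by rewrite divr_gt0.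
apply: filterS2 (near_lim e20) (lim_near e20) => B BH HB.
rewrite (@le_lt_trans _ _ (e / 2))//; last by rewrite ltr_pdivrMr// ltr_pMr// ltr1n.
apply: mdist_le_excess => [a Aa|b /BH[x Hx /ltW]]; first exact/ltW/HB.
exact/le_trans/dist_to_set_le.
Qed.

End ultralimit.

Lemma compact_hyperspace : compact [set: X] -> compact [set: hyperspaceC X].
Proof.
move=> cX; rewrite compact_ultra => F FF _.
by have [A FA] := hyperspace_ultra_cvg cX; exists A.
Qed.

End hyperspace.

(** * Decomposability at a given scale *)

Section coarsely_decomposable.
Context {R : realType} {X : metricType R}.
Implicit Types (A B H M : hyperspaceC X) (x y : X).

Definition coarsely_decomposable (e : R) : set (hyperspaceC X) :=
  [set A | exists H M, [/\ carrier A = carrier H `|` carrier M,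
    e <= excess (carrier A) (carrier H) & e <= excess (carrier A) (carrier M)]].

Lemma decomposableE : [set A : hyperspaceC X | decomposable (carrier A)] =
  \bigcup_i coarsely_decomposable i.+1%:R^-1.
Proof.
have proper_excess A B : carrier B `<` carrier A ->
    0 < excess (carrier A) (carrier B).
  move=> BA; rewrite ltNge; apply/negP => AB0.
  move: BA; rewrite properEneq => -[/eqP + BA]; apply.
  apply/seteqP; split=> // x Ax; apply: dist_to_set0.
  exact: le_trans (dist_to_set_excess B Ax) AB0.
have excess_proper A B e : 0 < e -> e <= excess (carrier A) (carrier B) ->
    carrier B `<=` carrier A -> carrier B `<` carrier A.
  move=> e0 eAB BA; rewrite properEneq; split=> //; apply/eqP => E.
  move: (lt_le_trans e0 eAB); rewrite ltNge => /negP; apply.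
  apply: excess_le => a Aa; rewrite E.
  by rewrite (le_trans (dist_to_set_le a Aa))// mdistxx.
apply/seteqP; split=> A /=.
  move=> [H [M [cH cM HA MA AE]]].
  pose H' : hyperspaceC X := exist _ H (asboolT cH).
  pose M' : hyperspaceC X := exist _ M (asboolT cM).
  pose r := Num.min (excess (carrier A) (carrier H')) (excess (carrier A) (carrier M')).
  have r0 : 0 < r by rewrite lt_min !proper_excess.
  have [i ir] : exists i : nat, i.+1%:R^-1 < r.
    exists (Num.truncn r^-1); rewrite -ltf_pV2 ?posrE// ?invr_gt0// invrK.
    exact: truncnS_gt.
  exists i => //; exists H', M'; split=> //; apply: le_trans (ltW ir) _.
    by rewrite ge_min lexx.
  by rewrite ge_min lexx orbT.
move=> [i _ [H [M [AE HA MA]]]]; exists (carrier H), (carrier M).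
have i0 : 0 < i.+1%:R^-1 :> R by rewrite invr_gt0.
split => //; [exact: carrierP|exact: carrierP| |].
  by apply: excess_proper HA _ => //; rewrite AE; left.
by apply: excess_proper MA _ => //; rewrite AE; right.
Qed.

(** Decompositions of continua converging to [A] accumulate, by compactness of
    the hyperspace, at a pair [(H, M)]; unions and excesses pass to the
    limit. *)
Lemma closed_coarsely_decomposable (e : R) : compact [set: X] ->
  closed (coarsely_decomposable e).
Proof.
move=> cX A clA.
pose S (r : R) := [set HM : hyperspaceC X * hyperspaceC X | exists B,
  [/\ carrier B = carrier HM.1 `|` carrier HM.2,
    e <= excess (carrier B) (carrier HM.1), e <= excess (carrier B) (carrier HM.2)
    & mdist A B < r]].
pose F := filter_from [set r : R | 0 < r] S.
have FF : ProperFilter F.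
  apply: filter_from_proper; last first.
    move=> r r0; have := clA _ (nbhsx_ballx A r r0).
    rewrite ballEmdist => -[B [[H [M [BE HB MB]]] AB]].
    by exists (H, M), B.
  apply: filter_from_filter; first by exists 1 => /=.
  move=> r s r0 s0; exists (Num.min r s); first by rewrite /= lt_min r0.
  by move=> HM [B [? ? ?]]; rewrite lt_min => /andP[? ?]; split; exists B.
have [[H M] [_ HMF]] : ([set: _] `*` [set: _]) `&` cluster F !=set0.
  apply: (compact_setX (compact_hyperspace cX) (compact_hyperspace cX)).
  by exists 1 => //=.
have approx r : 0 < r -> exists B H' M', [/\ carrier B = carrier H' `|` carrier M',
    e <= excess (carrier B) (carrier H') /\ e <= excess (carrier B) (carrier M'),
    mdist A B < r, mdist H H' < r & mdist M M' < r].
  move=> r0; have FS : F (S r) by exists r.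
  have [|[H' M'] [[B [BE HB MB AB]] [/= HH MM]]] :=
      HMF (S r) (ball H r `*` ball M r) FS.
    by exists (ball H r, ball M r) => //; split; exact: nbhsx_ballx.
  by exists B, H', M'; split => //; move: HH MM; rewrite !ballEmdist.
have excess_lim (G : hyperspaceC X) : (forall r, 0 < r -> exists B G',
    [/\ e <= excess (carrier B) (carrier G'), mdist A B < r & mdist G G' < r]) ->
    e <= excess (carrier A) (carrier G).
  move=> GP; apply/ler_addgt0Pl => r r0.
  have [//|B [G' [eB AB GG]]] := GP (r / 2); first by rewrite divr_gt0.
  have := excess_triangle A B G'; have := excess_triangle G A G'.
  have := excess_le_mdist B A; have := excess_le_mdist G G'.
  by rewrite (metric_sym B A); lra.
exists H, M; split; last first.
- apply: excess_lim => r /approx[B [H' [M' [BE [HB MB] AB HH MM]]]].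
  by exists B, M'.
- apply: excess_lim => r /approx[B [H' [M' [BE [HB MB] AB HH MM]]]].
  by exists B, H'.
have lim_sub (G : hyperspaceC X) : (forall r, 0 < r -> exists B G',
    [/\ carrier G' `<=` carrier B, mdist A B < r & mdist G G' < r]) ->
    carrier G `<=` carrier A.
  move=> GP x Gx; apply: dist_to_set0; apply/ler_addgt0Pl => r r0; rewrite addr0.
  have [//|B [G' [GB AB GG]]] := GP (r / 2); first by rewrite divr_gt0.
  have [G'0 _ _] := carrierP G'; have [A0 _ _] := carrierP A.
  have [y G'y xy] : exists2 y, carrier G' y & mdist x y < r / 2.
    apply: dist_to_set_lt => //.
    exact: le_lt_trans (dist_to_set_le_mdist G' Gx) GG.
  rewrite (le_trans (dist_to_set_triangle x y A0))// (splitr r) lerD ?ltW//.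
  rewrite (le_lt_trans (dist_to_set_le_mdist A (GB _ G'y)))//.
  by rewrite metric_sym.
apply/seteqP; split=> [a Aa|x [Hx|Mx]]; last 2 first.
- apply: (lim_sub H) Hx => r /approx[B [H' [M' [BE _ AB HH MM]]]].
  by exists B, H'; rewrite BE; split => //; left.
- apply: (lim_sub M) Mx => r /approx[B [H' [M' [BE _ AB HH MM]]]].
  by exists B, M'; rewrite BE; split => //; right.
apply: contrapT => /not_orP[nH nM].
have pos (G : hyperspaceC X) : ~ carrier G a -> 0 < dist_to_set a (carrier G).
  by move=> nG; rewrite ltNge; apply/negP => /dist_to_set0.
pose r := Num.min (dist_to_set a (carrier H)) (dist_to_set a (carrier M)) / 2.
have r0 : 0 < r by rewrite divr_gt0// lt_min !pos.
have [B [H' [M' [BE _ AB HH MM]]]] := approx _ r0.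
have [B0 _ _] := carrierP B.
have [b Bb ab] : exists2 b, carrier B b & mdist a b < r.
  by apply: dist_to_set_lt => //; exact: le_lt_trans (dist_to_set_le_mdist B Aa) AB.
have far (G G' : hyperspaceC X) : carrier G' b -> mdist G G' < r ->
    dist_to_set a (carrier G) < r + r.
  move=> G'b GG; have [G0 _ _] := carrierP G.
  rewrite (le_lt_trans (dist_to_set_triangle a b G0))// ltrD//.
  by rewrite (le_lt_trans (dist_to_set_le_mdist G G'b))// metric_sym.
move: Bb; rewrite BE => -[H'b|M'b].
  by have := far _ _ H'b HH; rewrite -splitr lt_min ltxx.
by have := far _ _ M'b MM; rewrite -splitr lt_min ltxx andbF.
Qed.

End coarsely_decomposable.

(** * Unions of growing paths *)

Section growing_paths.
Context {R : realType} {X : metricType R} {I : finType}.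
Variables (p : I -> R -> X) (c : R).
Hypothesis p_lipschitz : forall i s t, mdist (p i s) (p i t) <= c * `|s - t|.

Let c_ge0 (i : I) : 0 <= c.
Proof.
by have := le_trans (mdist_ge0 _ _) (p_lipschitz i 1 0); rewrite subr0 normr1 mulr1.
Qed.

Lemma lipschitz_path_continuous i : continuous (p i).
Proof.
move=> s; apply/metricType_numDomainType.cvgrPdist_lt => e e0.
have c1 : 0 < c + 1 by rewrite ltr_pwDr ?c_ge0.
near=> t; rewrite (le_lt_trans (p_lipschitz i s t))//.
have st : `|s - t| < e / (c + 1).
  by near: t; apply: cvgr_dist_lt => //; rewrite divr_gt0.
rewrite (@le_lt_trans _ _ ((c + 1) * `|s - t|)) ?ler_wpM2r ?lerDl//.
by rewrite mulrC -ltr_pdivlMr.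
Unshelve. all: by end_near. Qed.

Lemma compact_paths (S : I -> set R) : (forall i, compact (S i)) ->
  compact [set x | exists i t, S i t /\ x = p i t].
Proof.
move=> cS; rewrite (_ : [set x | _] = \big[setU/set0]_(i : I) (p i @` S i)).
  apply: bigsetU_compact => i _; apply: continuous_compact => //.
  exact/continuous_subspaceT/lipschitz_path_continuous.
rewrite -bigcup_seq; apply/seteqP; split=> [x [i [t [St ->]]]|x [i _ [t St <-]]].
  by exists i; rewrite /= ?mem_index_enum//; exists t.
by exists i, t.
Qed.

(** Each path is drawn up to a time prescribed by [h]; it is complete when the
    time is at least 1 and absent when the time is negative. *)
Definition grown (h : I -> R) : set X :=
  [set x | exists i t, [/\ 0 <= t <= 1, t <= h i & x = p i t]].

Lemma compact_grown h : compact (grown h).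
Proof.
have -> : grown h = [set x | exists i t, `[0, Num.min 1 (h i)]%classic t /\ x = p i t].
  apply/seteqP; split=> [x [i [t [/andP[t0 t1] th ->]]]|x [i [t []]]].
    by exists i, t; split => //=; rewrite in_itv/= le_min t0 t1.
  rewrite /= in_itv/= le_min => /andP[t0 /andP[t1 th]] ->.
  by exists i, t; split=> //; apply/andP.
by apply: compact_paths => i; exact: segment_compact.
Qed.

Lemma grown_path_connected h i t : 0 <= t <= 1 -> t <= h i ->
  connected_component (grown h) (p i 0) (p i t).
Proof.
move=> /andP[t0 t1] th; exists (p i @` `[0, t]); last first.
  by exists t => //=; rewrite in_itv/= t0 lexx.
split; first by exists 0 => //=; rewrite in_itv/= lexx t0.
  move=> _ [s /= + <-]; rewrite in_itv/= => /andP[s0 st]; exists i, s.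
  by rewrite s0 (le_trans st t1) (le_trans st th).
apply: connected_continuous_connected; first exact: segment_connected.
exact/continuous_subspaceT/lipschitz_path_continuous.
Qed.

(** A path can only appear or disappear when its time crosses 0, that is, as its
    starting point.  The robustness condition makes this harmless: the
    starting point belongs to the set slightly before the path appears. *)
Lemma grown_continuous (Y : metricType R) (h : Y -> I -> R) (d : R)
    (f : Y -> hyperspaceC X) :
  0 <= d -> (forall y z i, h y i <= h z i + d * mdist y z) ->
  (forall y i, -1 < h y i -> grown (h y) (p i 0)) ->
  (forall y, carrier (f y) = grown (h y)) -> continuous f.
Proof.
move=> d0 h_lip robust fE.
have near_grown y z x : d * mdist y z < 1 -> grown (h y) x ->
    dist_to_set x (carrier (f z)) <= c * (d * mdist y z).
  move=> yz [i [t [/andP[t0 t1] th ->]]]; rewrite fE.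
  have dyz : 0 <= d * mdist y z by rewrite mulr_ge0// mdist_ge0.
  have := h_lip y z i => hyz.
  have [hz|hz] := leP 0 (h z i).
    have [thz|thz] := leP t (h z i).
      have Ex : grown (h z) (p i t) by exists i, t; rewrite t0 t1.
      rewrite (le_trans (dist_to_set_le _ Ex))// mdistxx mulr_ge0//.
      exact: c_ge0 i.
    have Ex : grown (h z) (p i (h z i)).
      by exists i, (h z i); rewrite hz; split=> //=; apply: ltW; exact: lt_le_trans t1.
    rewrite (le_trans (dist_to_set_le _ Ex))// (le_trans (p_lipschitz _ _ _))//.
    by rewrite ler_wpM2l ?(c_ge0 i)// ger0_norm ?subr_ge0; [lra|exact: ltW].
  (* the path is absent at [z], so it was short at [y]: use its start *)
  have Ex : grown (h z) (p i 0) by apply: robust; lra.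
  rewrite (le_trans (dist_to_set_le _ Ex))// (le_trans (p_lipschitz _ _ _))//.
  by rewrite ler_wpM2l ?(c_ge0 i)// subr0 ger0_norm//; lra.
move=> y; apply/metricType_numDomainType.cvgrPdist_lt => e e0.
have [i0 _|noi] := pickP I; last first.
  have [[x]] := carrierP (f y); rewrite fE => -[i]; by have := noi i.
have c0 := c_ge0 i0.
have cd : 0 < (c + 1) * (d + 1) by rewrite mulr_gt0// ltr_wpDl.
have bnd : forall r, 0 < r -> \forall z \near y, mdist y z < r.
  by move=> r r0; apply: open_nbhs_nbhs; split; [exact: open_mdist_lt|rewrite /= mdistxx].
have d1 : 0 < d + 1 by rewrite ltr_wpDl.
have c1 : 0 < c + 1 by rewrite ltr_wpDl.
near=> z.
have m0 : 0 <= mdist y z by exact: mdist_ge0.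
have yz1 : (d + 1) * mdist y z < 1.
  by rewrite mulrC -ltr_pdivlMr// div1r; near: z; apply: bnd; rewrite invr_gt0.
have yze : (c + 1) * ((d + 1) * mdist y z) < e.
  rewrite mulrA mulrC -ltr_pdivlMr//.
  by near: z; apply: bnd; rewrite divr_gt0.
have dd : d * mdist y z <= (d + 1) * mdist y z by rewrite ler_wpM2r// lerDl.
have dyz : d * mdist y z < 1 by exact: le_lt_trans yz1.
rewrite (le_lt_trans _ yze)//.
have cc : c * (d * mdist y z) <= (c + 1) * ((d + 1) * mdist y z).
  by rewrite ler_pM// ?mulr_ge0// lerDl.
apply: mdist_le_excess => x; rewrite fE => gx; apply: le_trans cc.
  exact: near_grown.
by rewrite metric_sym; apply: near_grown => //; rewrite metric_sym.
Unshelve. all: by end_near. Qed.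

End growing_paths.

(** * Points of the cube *)

Section cube_points.
Context {R : realType} {n : dimension}.

Definition clip (t : R) : R := Num.max 0 (Num.min 1 t).

Lemma clip01 t : 0 <= clip t <= 1.
Proof. by rewrite /clip le_max lexx/= ge_max ler01 ge_min lexx. Qed.

Lemma clip_id t : 0 <= t <= 1 -> clip t = t.
Proof. by move=> /andP[t0 t1]; rewrite /clip min_r// max_r. Qed.

Lemma clip_lipschitz s t : `|clip s - clip t| <= `|s - t|.
Proof.
rewrite /clip; case: (leP 1 s) => s1; case: (leP 1 t) => t1;
  rewrite ?(max_r ler01); case: (ger0P (s - t)) => st. all: case: (leP 0 s) => s0; case: (leP 0 t) => t0. all: rewrite ler_norml; apply/andP; split; lra.
Qed.

Lemma clip_in (t : R) : clip t \in (`[0, 1]%classic : set R).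
Proof. by rewrite inE /= in_itv /= clip01. Qed.

Definition clip_sub (t : R) : (`[0, 1]%classic : set R) := exist _ (clip t) (clip_in t).

Definition mkcube (v : cube_index n -> R) : cube R n := fun i => clip_sub (v i).

Lemma coord_mkcube v i : Defs.coord (mkcube v) i = clip (v i).
Proof. by []. Qed.

(** Tychonoff's theorem, the factors being images of the unit interval under
    [clip_sub]. *)
Lemma cube_compact : compact [set: cube R n].
Proof.
have cI : compact [set: (`[0, 1]%classic : set R)].
  have -> : [set: (`[0, 1]%classic : set R)] = clip_sub @` `[0, 1].
    apply/seteqP; split=> // x _; exists (\val x); first exact: set_valP x.
    apply: val_inj => /=; apply: clip_id; have := set_valP x.
    by rewrite /= in_itv.
  apply: continuous_compact; last exact: segment_compact.
  apply: continuous_subspaceT; apply: continuous_comp_initial => x.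
  apply/cvgrPdist_lt => e e0.
  have : \forall t \near x, `|x - t| < e by exact: (nbhsx_ballx x e e0).
  by apply: filterS => t; apply: le_lt_trans; exact: clip_lipschitz.
pose J : uniformType := (`[0, 1]%classic : set R).
have := @tychonoff {classic cube_index n} (fun=> J) (fun=> [set: J]) (fun=> cI).
rewrite (_ : [set f | _] = setT); first exact.
by apply/seteqP; split.
Qed.

End cube_points.

(** * Grid points and their heights *)

Section grid_points.
Context {R : realType} {n : dimension}.
Variables (m q : nat) (gamma : R).
Hypothesis gamma_gt0 : 0 < gamma.

Definition vertex : finType := {ffun 'I_m.+1 -> 'I_q.+1}.

Implicit Types (k l : vertex) (i : cube_index n) (s t u v : R).

(** On the path from [k] to [l] the coordinates move one after another, the
    one of rank [r] during the time interval from [r / (m + 1)] to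
    [(r + 1) / (m + 1)]. *)
Definition progress t (r : nat) : R := clip (m.+1%:R * t - r%:R).

(** The point at time [t] of the path from [k] to [l], translated along the
    diagonal in proportion to the height [u].  Only the coordinates of rank at
    most [m] are used; the others have little weight in the metric. *)
Definition grid_coord k l t u i : R :=
  if (index_rank i <= m)%N then
    ((k (inord (index_rank i)))%:R + progress t (index_rank i) *
      ((l (inord (index_rank i)))%:R - (k (inord (index_rank i)))%:R) +
      u * gamma) / q.+1%:R
  else 0.

Definition grid_point k l t u : cube R n := mkcube (grid_coord k l t u).

Let ltq k r : 0 <= ((k r)%:R : R) <= q%:R.
Proof. by rewrite ler0n ler_nat -ltnS ltn_ord. Qed.

Let progress01 t r : 0 <= progress t r <= 1. Proof. exact: clip01. Qed.

Let mix_bound (a b c : R) : 0 <= a <= q%:R -> 0 <= b <= q%:R -> 0 <= c <= 1 ->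
  0 <= a + c * (b - a) <= q%:R.
Proof. move=> /andP[? ?] /andP[? ?] /andP[? ?]; apply/andP; split; nra. Qed.

Lemma coord_grid_point k l t u i : 0 <= u * gamma <= 2^-1 ->
  Defs.coord (grid_point k l t u) i = grid_coord k l t u i.
Proof.
move=> /andP[u0 u1]; rewrite coord_mkcube clip_id// /grid_coord.
case: ifP => _; last by rewrite lexx ler01.
have /andP[M0 M1] := mix_bound (ltq k (inord (index_rank i)))
  (ltq l (inord (index_rank i))) (progress01 t (index_rank i)).
apply/andP; split; first by rewrite divr_ge0// addr_ge0.
by rewrite ler_pdivrMr// mul1r -natr1; lra.
Qed.

Lemma mdist_cube_le (x y : cube R n) e : 0 <= e ->
  (forall i, `|Defs.coord x i - Defs.coord y i| <= e) -> mdist x y <= e.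
Proof.
move=> e0 xy; apply: cube_dist_le => // i; rewrite /weighted_diff.
by rewrite (le_trans _ (xy i))// ler_piMl// exprn_ile1// invf_le1// ler1n.
Qed.

Lemma grid_point_lipschitz_time k l s t u :
  mdist (grid_point k l s u) (grid_point k l t u) <= m.+1%:R * `|s - t|.
Proof.
apply: mdist_cube_le => [|i]; first by rewrite mulr_ge0.
rewrite !coord_mkcube (le_trans (clip_lipschitz _ _))// /grid_coord.
case: ifP => _; last by rewrite subrr normr0 mulr_ge0.
set a := (k _)%:R; set b := (l _)%:R; set r := index_rank i.
have -> : (a + progress s r * (b - a) + u * gamma) / q.+1%:R -
   (a + progress t r * (b - a) + u * gamma) / q.+1%:R =
   (progress s r - progress t r) * ((b - a) / q.+1%:R) by field; rewrite nat1r pnatr_eq0.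
rewrite normrM (le_trans _ (_ : `|progress s r - progress t r| <= _))//.
  rewrite ler_piMr// normrM normfV ler_pdivrMr ?normr_gt0 ?pnatr_eq0// mul1r.
  have /andP[a0 a1] : 0 <= a <= q%:R by exact: ltq.
  have /andP[b0 b1] : 0 <= b <= q%:R by exact: ltq.
  by rewrite normr_nat -natr1 ler_norml; apply/andP; split; lra.
rewrite (le_trans (clip_lipschitz _ _))//.
have -> : m.+1%:R * s - r%:R - (m.+1%:R * t - r%:R) = m.+1%:R * (s - t) by ring.
by rewrite normrM ger0_norm.
Qed.

Lemma grid_point_lipschitz_height k l t u v :
  mdist (grid_point k l t u) (grid_point k l t v) <= gamma * `|u - v|.
Proof.
apply: mdist_cube_le => [|i]; first by rewrite mulr_ge0// ltW.
rewrite !coord_mkcube (le_trans (clip_lipschitz _ _))// /grid_coord.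
case: ifP => _; last by rewrite subrr normr0 mulr_ge0// ltW.
set a := (k _)%:R + _.
have -> : (a + u * gamma) / q.+1%:R - (a + v * gamma) / q.+1%:R =
   (gamma * (u - v)) / q.+1%:R by field; rewrite nat1r pnatr_eq0.
rewrite normrM normfV ler_pdivrMr ?normr_gt0 ?pnatr_eq0// normrM (gtr0_norm gamma_gt0).
by rewrite ler_peMr ?mulr_ge0 ?(ltW gamma_gt0)// normr_nat ler1n.
Qed.

Lemma grid_point_start k l u : grid_point k l 0 u = grid_point k k 0 u.
Proof.
congr mkcube; apply/funext => i; rewrite /grid_coord; case: ifP => // _.
have -> : progress 0 (index_rank i) = 0.
  rewrite /progress mulr0 sub0r /clip min_r; last by rewrite (le_trans _ ler01)// oppr_le0.
  by rewrite max_l// oppr_le0.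
by rewrite !mul0r.
Qed.

Lemma grid_point_end k l u : grid_point k l 1 u = grid_point l l 0 u.
Proof.
congr mkcube; apply/funext => i; rewrite /grid_coord; case: ifP => // rm.
have -> : progress 1 (index_rank i) = 1.
  by rewrite /progress mulr1 /clip min_l ?max_r// lerBrDr nat1r ler_nat ltnS.
by congr (_ / _); ring.
Qed.

Definition node k : cube R n := grid_point k k 0 0.

Lemma mdist_grid_point_node k l t u (mu : R) : 0 <= u * gamma <= 2^-1 ->
  q.+1%:R^-1 <= mu -> mdist (grid_point k l t u) (node k) <= mdist (node k) (node l) + mu.
Proof.
move=> u01 qmu; have mu0 : 0 <= mu by apply: le_trans qmu; rewrite invr_ge0.
apply: cube_dist_le => [|i]; first by rewrite addr_ge0// mdist_ge0.
have z01 : 0 <= 0 * gamma <= 2^-1 by rewrite mul0r lexx /= invr_ge0 ler0n.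
have kl : weighted_diff (node k) (node l) i <= mdist (node k) (node l).
  exact: weighted_diff_le.
rewrite (le_trans _ (lerD kl qmu))// /weighted_diff !coord_grid_point// /grid_coord.
have w0 : 0 <= (2^-1 : R) ^+ index_rank i by rewrite exprn_ge0.
have w1 : (2^-1 : R) ^+ index_rank i <= 1 by rewrite exprn_ile1// invf_le1// ler1n.
move: (_ ^+ _) w0 w1 => w w0 w1.
case: ifP => _; last by rewrite subrr normr0 mulr0 add0r invr_ge0.
rewrite !subrr !mulr0 !addr0 !mul0r !addr0.
have /andP[c0 c1] := progress01 t (index_rank i).
set a := (k _)%:R; set b := (l _)%:R; set c := progress _ _.
have -> : (a + c * (b - a) + u * gamma) / q.+1%:R - a / q.+1%:R =
  - (c * (a / q.+1%:R - b / q.+1%:R)) + u * gamma / q.+1%:R by field; rewrite nat1r pnatr_eq0.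
set d := a / _ - b / _.
have cd : `|c * d| <= `|d| by rewrite normrM (ger0_norm c0) ler_piMl.
have ug : `|u * gamma / q.+1%:R| <= q.+1%:R^-1.
  have /andP[u0 u1] := u01; rewrite ger0_norm ?divr_ge0// ler_piMl ?invr_ge0//.
  by rewrite (le_trans u1)// invf_le1// ler1n.
have := ler_normD (- (c * d)) (u * gamma / q.+1%:R); rewrite normrN => tri.
rewrite (le_trans (ler_wpM2l w0 (le_trans tri (lerD cd ug))))// mulrDr lerD2l.
by rewrite ler_piMl// invr_ge0.
Qed.

(** Round the coordinates of rank at most [m] down to grid values; the others
    contribute at most their weight. *)
Lemma node_net (mu : R) x : q.+1%:R^-1 <= mu ->
  (forall i, (m < index_rank i)%N -> 2^-1 ^+ index_rank i <= mu) ->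
  exists k, mdist (node k) x <= mu.
Proof.
move=> qmu tail; have mu0 : 0 <= mu by apply: le_trans qmu; rewrite invr_ge0.
have near_grid (r : 'I_m.+1) : exists a : 'I_q.+1, forall i, index_rank i = r ->
    `|a%:R / q.+1%:R - Defs.coord x i| <= q.+1%:R^-1.
  have [[i ir]|nor] := pselect (exists i, index_rank i = r); last first.
    by exists ord0 => i ir; case: nor; exists i.
  have /andP[x0 x1] := coord01 x i.
  pose y := q.+1%:R * Defs.coord x i.
  have y0 : 0 <= y by rewrite mulr_ge0.
  have yq : y <= q%:R + 1 by rewrite natr1 ler_piMr.
  have /andP[tl tr] := Num.Theory.truncn_itv y0.
  have aq : (minn (Num.truncn y) q < q.+1)%N by rewrite ltnS geq_minr.
  exists (Ordinal aq) => j jr; have -> : j = i by apply: index_rank_inj; rewrite jr.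
  have -> : (Ordinal aq)%:R / q.+1%:R - Defs.coord x i =
    ((Ordinal aq)%:R - y) / q.+1%:R by rewrite /y; field; rewrite nat1r pnatr_eq0.
  rewrite normrM normfV normr_nat ler_piMl ?invr_ge0// ler_norml /=.
  rewrite -natr1 in tr; case: leqP => tq; first by apply/andP; split; lra.
  have : q%:R + 1 <= (Num.truncn y)%:R :> R by rewrite natr1 ler_nat.
  by move=> ?; apply/andP; split; lra.
have [k kP] := choice near_grid.
exists [ffun r => k r]; apply: cube_dist_le => // i.
rewrite /weighted_diff coord_grid_point; last by rewrite mul0r lexx /= invr_ge0 ler0n.
rewrite /grid_coord; case: leqP => im; last first.
  rewrite (le_trans _ (tail i im))// ler_piMr ?exprn_ge0// sub0r normrN.
  by have /andP[x0 x1] := coord01 x i; rewrite ger0_norm.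
rewrite !ffunE subrr mulr0 mul0r !addr0.
have := kP (inord (index_rank i)) i; rewrite inordK// => /(_ erefl) ki.
rewrite (le_trans _ qmu)// (le_trans _ ki)// ler_piMl// exprn_ile1//.
by rewrite invf_le1// ler1n.
Qed.

(** The time intervals in which two different coordinates move have disjoint
    interiors. *)
Let progress_frac t (r r' : nat) : 0 < progress t r < 1 -> 0 < progress t r' < 1 ->
  r = r'.
Proof.
have inside (y : R) : 0 < clip y < 1 -> 0 < y < 1.
  by rewrite /clip lt_max ltxx/= lt_min ltr01/= gt_max ltr01/= gt_min ltxx/=.
move=> /inside/andP[r0 r1] /inside/andP[s0 s1].
have : (r%:R < r'%:R + 1 :> R) /\ (r'%:R < r%:R + 1 :> R) by split; lra.
by rewrite !natr1 !ltr_nat !ltnS => -[? ?]; apply/eqP; rewrite eqn_leq; apply/andP.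
Qed.

(** In each representation of a point at most one coordinate is moving, so
    among three coordinates there is one that is at rest in both.  This
    coordinate is a grid value plus [u * gamma] and also a grid value plus
    [v * gamma], and the offsets are too small to differ by a grid step. *)
Lemma grid_point_height k l k' l' s t u v :
  (2 <= m)%N -> (forall r, (r < 3)%N -> exists i, index_rank i = r) ->
  0 <= u * gamma <= 2^-1 -> 0 <= v * gamma <= 2^-1 ->
  grid_point k l s u = grid_point k' l' t v -> u = v.
Proof.
move=> m2 rank3 u01 v01 E.
pose bad t r := 0 < progress t r < 1.
have [i [i3 si ti]] : exists i, [/\ (index_rank i < 3)%N,
    ~~ bad s (index_rank i) & ~~ bad t (index_rank i)].
  have [r [r3 sr tr]] : exists r, [/\ (r < 3)%N, ~~ bad s r & ~~ bad t r].
    apply: contrapT => no.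
    have {}no r : (r < 3)%N -> bad s r \/ bad t r.
      move=> r3; apply: contrapT => /not_orP[nS nT]; apply: no; exists r.
      by split => //; exact/negP.
    have := no 0%N isT; have := no 1%N isT; have := no 2%N isT.
    by do 3 case=> ?; match goal with
      H1 : is_true (bad ?t ?r), H2 : is_true (bad ?t ?r') |- _ =>
        by have := progress_frac H1 H2 end.
  by have [i ir] := rank3 r r3; exists i; rewrite ir.
have im : (index_rank i <= m)%N by rewrite (leq_trans _ m2)// -ltnS.
have := congr1 (fun x => Defs.coord x i) E.
rewrite /= !coord_grid_point// /grid_coord im.
move=> /(congr1 (fun y => y * q.+1%:R)); rewrite !mulfVK ?pnatr_eq0//.
have good a b tt : ~~ bad tt (index_rank i) -> exists c : nat,
    a%:R + progress tt (index_rank i) * (b%:R - a%:R) = c%:R :> R.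
  rewrite /bad => ntt; have /andP[p0 p1] := progress01 tt (index_rank i).
  move: ntt; rewrite negb_and -!leNgt => /orP[pl|pg].
    by exists a; rewrite (_ : progress _ _ = 0) ?mul0r ?addr0//; apply/eqP; rewrite eq_le pl.
  exists b; rewrite (_ : progress _ _ = 1) ?mul1r ?(addrC a%:R) ?subrK//.
  by apply/eqP; rewrite eq_le p1.
have [c ->] := good (k (inord (index_rank i))) (l (inord (index_rank i))) s si.
have [d ->] := good (k' (inord (index_rank i))) (l' (inord (index_rank i))) t ti.
have /andP[u0 u1] := u01; have /andP[v0 v1] := v01 => cd.
have cdE : c = d.
  have : (c%:R < d%:R + 1 :> R) /\ (d%:R < c%:R + 1 :> R) by split; lra.
  by rewrite !natr1 !ltr_nat !ltnS => -[? ?]; apply/eqP; rewrite eqn_leq; apply/andP.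
move: cd; rewrite cdE => /addrI/(mulIf (lt0r_neq0 gamma_gt0)).
exact.
Qed.

End grid_points.

(** * The stack of translated graphs *)

Lemma min_le_add (R : realDomainType) (a b a' b' d : R) :
  a <= a' + d -> b <= b' + d -> Num.min a b <= Num.min a' b' + d.
Proof. by move=> aa bb; rewrite -lerBlDr le_min !lerBlDr !ge_min aa bb orbT. Qed.

Section stack.
Context {R : realType} {n : dimension}.
Variables (m q : nat) (mu : R).

Local Notation V := (vertex m q).
Local Notation hyper := (hyperspaceC (cube R n)).

Definition half_height : nat := #|V|.
Definition top_height : nat := half_height + half_height.
(** With this distance between levels the total offset is at most half a grid
    step. *)
Definition spacing : R := (2 * top_height%:R)^-1.

Implicit Types (k l : V) (K : hyper) (t u : R).

Local Notation point k l t u := (@grid_point R n m q spacing k l t u).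
Local Notation nod k := (@node R n m q spacing k).

(** Both halves of the stack run through all vertices, so that crossing either
    of them forces a subcontinuum to pass near all of [K]. *)
Definition gap_vertex (j : nat) : V :=
  nth [ffun=> ord0] (enum V) (if (j < half_height)%N then j else j - half_height)%N.

(** Edges at each level, and connectors in each gap. *)
Definition stack_index : finType :=
  ('I_top_height.+1 * V * V + 'I_top_height * V)%type.

Definition stack_path (i : stack_index) t : cube R n :=
  match i with
  | inl (j, k, l) => point k l t j%:R
  | inr (j, k) => point k k 0 (j%:R + t)
  end.

Definition height (i : stack_index) t : R :=
  match i with inl (j, _, _) => j%:R | inr (j, _) => j%:R + t end.

(** Distances from [K] are measured in units of the mesh [mu]. *)
Definition remoteness K k : R := dist_to_set (nod k) (carrier K) / mu.

(** Every point of [K] has a node at remoteness at most 1 within distance 1 (in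
    units of [mu]).  An edge from [k] is complete when [k] is at remoteness at
    most 1 and [l] at remoteness at most 4 and at distance at most 5 from [k];
    so all vertices at remoteness less than 4 are present as ends of complete
    edges.  A path with growth greater than -1 starts at such a vertex, with the
    margin that continuity requires.

    In a gap whose vertex has remoteness at most 2 the connector over this vertex
    is complete.  The other connectors have growth at most 0 as long as this
    remoteness is at most 1, and those over vertices at remoteness at most 1 are
    complete once it is at least 2. *)
Definition growth K (i : stack_index) : R :=
  match i with
  | inl (_, k, l) => Num.min (Num.min (2 - remoteness K k) (5 - remoteness K l))
                             (6 - mdist (nod k) (nod l) / mu)
  | inr (j, k) =>
      if k == gap_vertex j then 3 - remoteness K k
      else Num.min (2 - remoteness K k) (remoteness K (gap_vertex j) - 1)
  end.

Definition stack_set K : set (cube R n) := grown stack_path (growth K).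

Hypothesis mu_gt0 : 0 < mu.
Hypothesis mesh : q.+1%:R^-1 <= mu.
Hypothesis net : forall x, exists k, mdist (nod k) x <= mu.

Lemma half_height_gt0 : (0 < half_height)%N.
Proof. by apply/card_gt0P; exists [ffun=> ord0]. Qed.

Lemma top_height_gt0 : (0 < top_height)%N.
Proof. by rewrite addn_gt0 half_height_gt0. Qed.

Lemma spacing_gt0 : 0 < spacing.
Proof. by rewrite invr_gt0 mulr_gt0// ltr0n top_height_gt0. Qed.

Lemma gap_vertex_lower k : exists2 j, (j < half_height)%N & gap_vertex j = k.
Proof.
exists (index k (enum V)); first by rewrite /half_height cardE index_mem mem_enum.
by rewrite /gap_vertex /half_height cardE index_mem mem_enum nth_index// mem_enum.
Qed.

Lemma gap_vertex_upper k :
  exists2 j, (half_height <= j < top_height)%N & gap_vertex j = k.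
Proof.
have [j jv <-] := gap_vertex_lower k; exists (half_height + j)%N.
  by rewrite leq_addr ltn_add2l.
by rewrite /gap_vertex ltnNge leq_addr /= addKn jv.
Qed.

Lemma height_spacing u : 0 <= u <= top_height%:R -> 0 <= u * spacing <= 2^-1.
Proof.
move=> /andP[u0 uN]; rewrite mulr_ge0 ?(ltW spacing_gt0)//=.
rewrite /spacing ler_pdivrMr ?mulr_gt0 ?ltr0n ?top_height_gt0//.
by rewrite mulrA mulVf ?mul1r// pnatr_eq0.
Qed.

Lemma height_bounds i t : 0 <= t <= 1 -> 0 <= height i t <= top_height%:R.
Proof.
move=> /andP[t0 t1]; case: i => [[[j k] l]|[j k]] /=.
  by rewrite ler0n ler_nat -ltnS ltn_ord.
rewrite addr_ge0//= (le_trans (lerD (lexx _) t1))// natr1 ler_nat.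
exact: ltn_ord.
Qed.

Lemma stack_path_lipschitz i s t :
  mdist (stack_path i s) (stack_path i t) <= (m.+1%:R + spacing) * `|s - t|.
Proof.
have g0 := spacing_gt0; rewrite mulrDl; case: i => [[[j k] l]|[j k]] /=.
  rewrite (le_trans (grid_point_lipschitz_time _ _ _ _ _ _))//.
  by rewrite lerDl mulr_ge0// ltW.
rewrite (le_trans (grid_point_lipschitz_height spacing_gt0 _ _ _ _ _))//.
by rewrite opprD addrACA subrr add0r lerDr mulr_ge0.
Qed.

Lemma remoteness_lipschitz K K' k :
  remoteness K k <= remoteness K' k + mu^-1 * mdist K K'.
Proof.
rewrite /remoteness (mulrC mu^-1) -mulrDl ler_wpM2r ?invr_ge0 ?(ltW mu_gt0)//.
apply/ler_addgt0Pl => e e0; have [K'0 _ _] := carrierP K'; have [K0 _ _] := carrierP K.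
have [x K'x nx] : exists2 x, carrier K' x &
    mdist (nod k) x < dist_to_set (nod k) (carrier K') + e.
  by apply: dist_to_set_lt => //; rewrite ltrDl.
have := dist_to_set_triangle (nod k) x K0.
have := dist_to_set_le_mdist K K'x; rewrite (metric_sym K'); lra.
Qed.

Lemma growth_lipschitz K K' i :
  growth K i <= growth K' i + mu^-1 * mdist K K'.
Proof.
have d0 : 0 <= mu^-1 * mdist K K' by rewrite mulr_ge0 ?mdist_ge0// invr_ge0 ltW.
have L k := remoteness_lipschitz K K' k.
have L' k : remoteness K' k <= remoteness K k + mu^-1 * mdist K K'.
  by rewrite (metric_sym K); exact: remoteness_lipschitz.
case: i => [[[j k] l]|[j k]] /=.
  by apply: min_le_add; [apply: min_le_add|]; [have := L' k|have := L' l|]; lra.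
case: ifP => _; first by have := L' k; lra.
by apply: min_le_add; [have := L' k|have := L (gap_vertex j)]; lra.
Qed.


Lemma near_node K x : carrier K x ->
  exists k, mdist (nod k) x <= mu /\ remoteness K k <= 1.
Proof.
move=> Kx; have [k kx] := net x; exists k; split => //.
by rewrite ler_pdivrMr// mul1r (le_trans (dist_to_set_le _ Kx)).
Qed.

Lemma remoteness_lt K k r : remoteness K k < r ->
  exists2 x, carrier K x & mdist (nod k) x < r * mu.
Proof.
have [K0 _ _] := carrierP K.
by rewrite ltr_pdivrMr// => /(dist_to_set_lt K0).
Qed.

Lemma growth_edge K (j : 'I_top_height.+1) k l :
  remoteness K k <= 1 -> remoteness K l <= 4 -> mdist (nod k) (nod l) <= 5 * mu ->
  1 <= growth K (inl (j, k, l)).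
Proof.
move=> Kk Kl kl; rewrite /= !le_min; apply/andP; split; first by apply/andP; split; lra.
have : mdist (nod k) (nod l) / mu <= 5 by rewrite ler_pdivrMr.
lra.
Qed.

Lemma edge_connected K (j : 'I_top_height.+1) k l :
  remoteness K k <= 1 -> remoteness K l <= 4 -> mdist (nod k) (nod l) <= 5 * mu ->
  connected_component (stack_set K) (point k k 0 j%:R) (point l l 0 j%:R).
Proof.
move=> Kk Kl kl.
have := @grown_path_connected _ _ _ _ _ stack_path_lipschitz (growth K)
  (inl (j, k, l)) 1 _ (growth_edge j Kk Kl kl).
by rewrite /= grid_point_start grid_point_end; apply; rewrite ler01 lexx.
Qed.

Lemma vertex_connected K (j : 'I_top_height.+1) l : remoteness K l < 4 ->
  exists2 k, remoteness K k <= 1 & 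
    connected_component (stack_set K) (point k k 0 j%:R) (point l l 0 j%:R).
Proof.
move=> Kl; have [x Kx lx] := remoteness_lt Kl.
have [k [kx Kk]] := near_node Kx; exists k => //.
apply: edge_connected => //; first exact: ltW.
have := metric_triangle (nod k) x (nod l); rewrite (metric_sym x); lra.
Qed.

Lemma vertex_in_stack K (j : 'I_top_height.+1) k : remoteness K k < 4 ->
  stack_set K (point k k 0 j%:R).
Proof. by move=> /vertex_connected-/(_ j)[l _ /connected_component_sub]. Qed.

Lemma stack_path_start_vertex K i : -1 < growth K i ->
  exists (j : 'I_top_height.+1) k,
    remoteness K k < 4 /\ stack_path i 0 = point k k 0 j%:R.
Proof.
case: i => [[[j k] l]|[j k]] /=.
  rewrite !lt_min => /andP[/andP[Kk _] _]; exists j, k.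
  by split; [lra|rewrite grid_point_start].
move=> g; exists (widen_ord (leqnSn _) j), k; rewrite /= addr0; split => //.
by move: g; case: ifP => _; [lra|rewrite lt_min => /andP[? _]; lra].
Qed.

Lemma stack_robust K i : -1 < growth K i -> stack_set K (stack_path i 0).
Proof.
by move=> /stack_path_start_vertex[j [k [Kk ->]]]; exact: vertex_in_stack.
Qed.

(** It suffices to join vertices at remoteness at most 1.  The points of [K]
    closer than [2 * mu] to such a vertex joined to [k0] form a subset of [K]
    that is open; it is also closed, because all its points are within [mu] of
    such a vertex.  So it is all of [K]. *)
Lemma level_connected K (j : 'I_top_height.+1) k l :
  remoteness K k < 4 -> remoteness K l < 4 ->
  connected_component (stack_set K) (point k k 0 j%:R) (point l l 0 j%:R).
Proof.
pose cc := connected_component (stack_set K).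
pose pt k := point k k 0 j%:R.
suff main k0 l0 : remoteness K k0 <= 1 -> remoteness K l0 <= 1 -> cc (pt k0) (pt l0).
  move=> /vertex_connected-/(_ j)[k0 Kk0 kk0] /vertex_connected-/(_ j)[l0 Kl0 ll0].
  apply: connected_component_trans ll0; apply: connected_component_trans (main k0 l0 Kk0 Kl0).
  exact: connected_component_sym.
move=> Kk0 Kl0; pose good k := remoteness K k <= 1 /\ cc (pt k0) (pt k).
pose B := carrier K `&` \bigcup_(k in good) [set x | mdist (nod k) x < 2 * mu].
have close_good k1 l1 x : good k1 -> mdist (nod k1) x < 2 * mu ->
    remoteness K l1 <= 1 -> mdist (nod l1) x <= 2 * mu -> good l1.
  move=> [Kk1 kk1] k1x Kl1 l1x; split => //.
  apply: (connected_component_trans kk1); apply: edge_connected => //; first by lra.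
  have := metric_triangle (nod k1) x (nod l1); rewrite (metric_sym x).
  by have := mu_gt0; lra.
have BE : B = carrier K `&` \bigcup_(k in good) [set x | mdist (nod k) x <= mu].
  apply/seteqP; split=> x [Kx [k1 gk1 /= k1x]]; split => //; last first.
    by exists k1 => //=; have := mu_gt0; lra.
  have [l1 [l1x Kl1]] := near_node Kx; exists l1 => //.
  by apply: (close_good k1 l1 x) => //; have := mu_gt0; lra.
have gk0 : good k0.
  split => //; apply: connected_component_refl; apply: vertex_in_stack; lra.
have [_ _ conK] := carrierP K.
have BK : B = carrier K.
  apply: conK.
  - have [|x Kx k0x] := @remoteness_lt K k0 2; first by lra.
    by exists x; split => //; exists k0.
  - eexists; last by reflexivity.
    by apply: bigcup_open => k1 _; exact: open_mdist_lt.
  - eexists; last exact: BE.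
    by apply: closed_bigcup => //; [exact: finite_finset|move=> k1 _; exact: closed_mdist_le].
have [|x] := @remoteness_lt K l0 2; first by lra.
rewrite -BK => -[_ [k1 gk1 /= k1x]] l0x.
by have [] := close_good k1 l0 x gk1 k1x Kl0 (ltW l0x).
Qed.

Lemma gap_connected K (j : 'I_top_height) k l :
  remoteness K k < 4 -> remoteness K l < 4 ->
  connected_component (stack_set K) (point k k 0 j%:R) (point l l 0 j.+1%:R).
Proof.
move=> Kk Kl.
have [k1 [Kk1 g]] : exists k1, remoteness K k1 < 4 /\ 1 <= growth K (inr (j, k1)).
  have [Kg|Kg] := leP (remoteness K (gap_vertex j)) 2.
    by exists (gap_vertex j); rewrite /= eqxx; split; lra.
  have [[x Kx] _ _] := carrierP K; have [k1 [_ Kk1]] := near_node Kx.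
  exists k1; split; first by lra.
  rewrite /=; case: eqP => [k1g|_]; first by rewrite k1g in Kk1; lra.
  by rewrite le_min; apply/andP; split; lra.
have C : connected_component (stack_set K) (point k1 k1 0 j%:R) (point k1 k1 0 j.+1%:R).
  have := @grown_path_connected _ _ _ _ _ stack_path_lipschitz (growth K)
    (inr (j, k1)) 1 _ g.
  by rewrite /= addr0 natr1; apply; rewrite ler01 lexx.
apply: (connected_component_trans (level_connected (widen_ord (leqnSn _) j) Kk Kk1)).
exact: (connected_component_trans C (@level_connected K (lift ord0 j) k1 l Kk1 Kl)).
Qed.

Lemma stack_continuum K : continuum (stack_set K).
Proof.
have [[x Kx] _ _] := carrierP K; have [k0 [_ Kk0]] := near_node Kx.
have Kk04 : remoteness K k0 < 4 by lra.
pose base := point k0 k0 0 0%:R.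
have Gbase : stack_set K base by exact: (vertex_in_stack ord0 Kk04).
have level j k : (j <= top_height)%N -> remoteness K k < 4 ->
    connected_component (stack_set K) base (point k k 0 j%:R).
  elim: j k => [|j IH] k jN Kk; first exact: (level_connected ord0 Kk04 Kk).
  apply: connected_component_trans (IH k (ltnW jN) Kk) _.
  exact: (@gap_connected K (Ordinal jN) k k Kk Kk).
split; first by exists base.
  exact: compact_grown stack_path_lipschitz _.
suff -> : stack_set K = connected_component (stack_set K) base.
  exact: component_connected.
apply/seteqP; split; last exact: connected_component_sub.
move=> _ [i [t [t01 th ->]]].
have [j [k [Kk E]]] : exists (j : 'I_top_height.+1) k,
    remoteness K k < 4 /\ stack_path i 0 = point k k 0 j%:R.
  by apply: (@stack_path_start_vertex K); move/andP: t01 => [t0 _]; lra.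
apply: connected_component_trans (level j k (ltn_ord j) Kk) _; rewrite -E.
exact: grown_path_connected stack_path_lipschitz _ _ _ t01 th.
Qed.

Definition stack K : hyper := exist _ (stack_set K) (asboolT (stack_continuum K)).

Lemma stack_continuous : continuous stack.
Proof.
apply: (@grown_continuous _ _ _ stack_path _ stack_path_lipschitz _ growth mu^-1).
- by rewrite invr_ge0 ltW.
- exact: growth_lipschitz.
- exact: stack_robust.
- by [].
Qed.


(** A bound for the position of a path that is drawn over [K], together with the
    representation from which its height can be read off. *)
Lemma stack_pathE i t :
  exists k l s, stack_path i t = point k l s (height i t) /\
    forall K, 0 <= growth K i ->
      remoteness K k <= 3 /\ mdist (nod k) (nod l) <= 6 * mu.
Proof.
case: i => [[[j k] l]|[j k]] /=.
  exists k, l, t; split=> // K; rewrite !le_min => /andP[/andP[Kk _] kl].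
  by split; [lra|rewrite -ler_pdivrMr//; lra].
exists k, k, 0; split=> // K g; split; last by rewrite mdistxx mulr_ge0// ltW.
by move: g; case: ifP => _; [lra|rewrite le_min => /andP[? _]; lra].
Qed.

Lemma stack_near K x : stack_set K x ->
  exists2 y, carrier K y & mdist x y < 11 * mu.
Proof.
move=> [i [t [t01 tg ->]]]; have /andP[t0 t1] := t01.
have [k [l [s [-> /(_ K (le_trans t0 tg))[Kk kl]]]]] := stack_pathE i t.
have [|y Ky ky] := @remoteness_lt K k 4; first by lra.
exists y => //.
have pk := @mdist_grid_point_node R n m q spacing k l s _ mu (height_spacing (height_bounds i t01)) mesh.
rewrite (le_lt_trans (metric_triangle _ (nod k) y))//.
rewrite (le_lt_trans (lerD pk (lexx _)))//; lra.
Qed.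

Lemma mdist_stack K : mdist (stack K) K <= 11 * mu.
Proof.
apply: mdist_le_excess => [x /stack_near[y Ky /ltW]|y Ky].
  exact/le_trans/dist_to_set_le.
have [k [ky Kk]] := near_node Ky.
have kG : carrier (stack K) (nod k).
  by apply: (vertex_in_stack ord0); lra.
rewrite (le_trans (dist_to_set_le y kG))// metric_sym; have := mu_gt0; lra.
Qed.

Hypothesis m_ge2 : (2 <= m)%N.
Hypothesis three_coords : forall r, (r < 3)%N ->
  exists i : cube_index n, index_rank i = r.

Let mid (j : nat) := point (gap_vertex j) (gap_vertex j) 0 (j%:R + 2^-1).

Let half_neq (a b : nat) : a%:R <> b%:R + 2^-1 :> R.
Proof.
move=> E; have : (a < b.+1)%N /\ (b < a)%N.
  by rewrite -!(ltr_nat R) -natr1; split; lra.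
by move=> [? ?]; lia.
Qed.

(** Heights are determined by points, so a common point of the lower and the
    upper part has height exactly [j + 1/2]; it lies on a connector, and the
    only connector drawn so far up is the one over the vertex of the gap. *)
Lemma stack_cut K (j : 'I_top_height) i s i' t : remoteness K (gap_vertex j) <= 1 ->
  0 <= s <= 1 -> s <= growth K i -> height i s <= j%:R + 2^-1 ->
  0 <= t <= 1 -> t <= growth K i' -> j%:R + 2^-1 <= height i' t ->
  stack_path i s = stack_path i' t -> stack_path i s = mid j.
Proof.
move=> Kj s01 sg hs t01 tg ht E.
have [k [l [s' [Es _]]]] := stack_pathE i s.
have [k' [l' [t' [Et _]]]] := stack_pathE i' t.
have hE : height i s = height i' t.
  move: E; rewrite Es Et; apply: grid_point_height => //; first exact: spacing_gt0.
    by apply: height_spacing; exact: height_bounds.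
  by apply: height_spacing; exact: height_bounds.
have {hs ht hE E Es Et} : height i s = j%:R + 2^-1 by apply/eqP; rewrite eq_le hs hE.
case: i sg => [[[a k0] l0]|[a k0]] /= sg; first by move/half_neq.
move=> as_; have /andP[s0 s1] := s01.
have aj : (a : nat) = j.
  have : (a < j.+1)%N /\ (j < a.+1)%N.
    by rewrite -!(ltr_nat R) -!natr1; split; lra.
  by move=> [? ?]; lia.
move: sg; case: eqP => [->|_].
  by rewrite /mid -as_ aj.
by rewrite aj le_min => /andP[_ sj]; exfalso; move: as_; rewrite aj; lra.
Qed.

(** The lower and the upper part of the stack are closed, cover it and
    have no other point than [mid j] in common. *)
Lemma stack_crossing K (H : set (cube R n)) (j : 'I_top_height) i s i' t :
  remoteness K (gap_vertex j) <= 1 -> connected H -> H `<=` stack_set K ->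
  0 <= s <= 1 -> s <= growth K i -> height i s <= j%:R + 2^-1 ->
  H (stack_path i s) ->
  0 <= t <= 1 -> t <= growth K i' -> j%:R + 2^-1 <= height i' t ->
  H (stack_path i' t) ->
  H (mid j).
Proof.
move=> Kj cH HG s01 sg hs His t01 tg ht Hit; apply: contrapT => nmid.
pose piece (P : set R) (a : stack_index) :=
  `[0, Num.min 1 (growth K a)]%classic `&` (height a @^-1` P).
have piece_compact P a : closed P -> compact (piece P a).
  move=> cP; apply: compact_closedI; first exact: segment_compact.
  apply: closed_comp cP => r _; case: a => [[[b k] l]|[b k]] /=.
    exact: cst_continuous.
  by apply: cvgD; [exact: cvg_cst|exact: cvg_id].
pose part P := [set x | exists a r, piece P a r /\ x = stack_path a r].
have part_closed P : closed P -> closed (part P).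
  move=> cP; apply: compact_closed; first exact: metric_hausdorff.
  by apply: (compact_paths stack_path_lipschitz) => a; exact: piece_compact.
pose L := part [set u | u <= j%:R + 2^-1]; pose U := part [set u | j%:R + 2^-1 <= u].
have HLU x : H x -> L x \/ U x.
  move=> /HG[a [r [/andP[r0 r1] rg ->]]].
  have r01 : `[0, Num.min 1 (growth K a)]%classic r by rewrite /= in_itv/= r0 le_min r1.
  by have [hr|/ltW hr] := leP (height a r) (j%:R + 2^-1); [left|right]; exists a, r.
have LU x : H x -> L x -> U x -> False.
  move=> Hx [a [r [[+ hr] xr]]] [b [w [[+ hw] xw]]].
  rewrite /= !in_itv/= !le_min => /andP[r0 /andP[r1 rg]] /andP[w0 /andP[w1 wg]].
  have xm : x = mid j.
    by rewrite xr; apply: (@stack_cut K j a r b w) => //; rewrite ?r0 ?w0// -xr.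
  by apply: nmid; rewrite -xm.
have part_mem P a r : 0 <= r <= 1 -> r <= growth K a -> P (height a r) ->
    part P (stack_path a r).
  move=> /andP[r0 r1] rg Pr; exists a, r; split => //; split => //=.
  by rewrite in_itv/= r0 le_min r1.
have HL : H `&` L = H.
  apply: cH.
  - by exists (stack_path i s); split => //; exact: part_mem.
  - exists (~` U); first by apply: closed_openC; apply: part_closed; exact: closed_ge.
    apply/seteqP; split=> x [Hx Px]; split => //; first by move=> /(LU _ Hx Px).
    by case: (HLU x Hx).
  - by exists L => //; apply: part_closed; exact: closed_le.
have [_ Lit] : (H `&` L) (stack_path i' t) by rewrite HL.
by apply: (LU _ Hit Lit); exact: part_mem.
Qed.



(** Points of the stack are close to [K], points of [K] are close to nodes, and
    the midpoints of connectors are close to the nodes of their vertices. *)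
Lemma excess_stack_le K (G : hyper) : (forall k, remoteness K k <= 1 ->
    exists2 j : 'I_top_height, gap_vertex j = k & carrier G (mid j)) ->
  excess (carrier (stack K)) (carrier G) <= 13 * mu.
Proof.
move=> midG; apply: excess_le => x /stack_near[y Ky xy].
have [k [ky Kk]] := near_node Ky; have [j jk Gj] := midG k Kk.
rewrite (le_trans (dist_to_set_le _ Gj))// (le_trans (metric_triangle x y _))//.
have jN : 0 <= j%:R + 2^-1 :> R /\ j%:R + 2^-1 <= top_height%:R :> R.
  have : j.+1%:R <= top_height%:R :> R by rewrite ler_nat ltn_ord.
  by have := ler0n R j; rewrite -natr1; split; lra.
have j01 : 0 <= (j%:R + 2^-1 : R) <= top_height%:R by case: jN => -> ->.
have pk := @mdist_grid_point_node R n m q spacing k k 0 _ mu (height_spacing j01) mesh.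
rewrite mdistxx add0r in pk; rewrite /mid jk.
have ym := metric_triangle y (nod k) (point k k 0 (j%:R + 2^-1)).
rewrite (metric_sym y (nod k)) (metric_sym (nod k) (point _ _ _ _)) in ym.
rewrite (le_trans (lerD (ltW xy) (le_trans ym (lerD ky pk))))//; lra.
Qed.

Lemma excess_two_levels K (G : hyper) k0 (a b : 'I_top_height.+1) :
  remoteness K k0 <= 1 -> carrier G `<=` stack_set K ->
  carrier G (point k0 k0 0 a%:R) -> carrier G (point k0 k0 0 b%:R) ->
  (forall k, exists2 j : nat, (a <= j < b)%N & gap_vertex j = k) ->
  excess (carrier (stack K)) (carrier G) <= 13 * mu.
Proof.
move=> Kk0 GK Ga Gb ab; apply: excess_stack_le => k Kk.
have [j /andP[aj jb] jk] := ab k.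
have jN : (j < top_height)%N by rewrite (leq_trans jb)// -ltnS.
exists (Ordinal jN) => //; have [_ _ cG] := carrierP G.
have g0 c : 0 <= growth K (inl (c, k0, k0)).
  by apply: le_trans ler01 (growth_edge c Kk0 _ _); [lra|rewrite mdistxx mulr_ge0// ltW].
have z01 : 0 <= (0 : R) <= 1 by apply/andP; split; lra.
apply: (@stack_crossing K (carrier G) (Ordinal jN) (inl (a, k0, k0)) 0 (inl (b, k0, k0)) 0) => //.
- by rewrite /= jk.
- have /= : a%:R <= j%:R :> R by rewrite ler_nat.
  lra.
- have /= : j.+1%:R <= b%:R :> R by rewrite ler_nat.
  rewrite -natr1; lra.
Qed.

(** Of three points, at the bottom, middle and top levels, one of the two
    subcontinua contains two. *)
Lemma stack_not_coarsely_decomposable K e :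
  13 * mu < e -> ~ coarsely_decomposable e (stack K).
Proof.
move=> mue [H [M [GE HG MG]]].
have [[x Kx] _ _] := carrierP K; have [k0 [_ Kk0]] := near_node Kx.
have hN : (half_height < top_height.+1)%N by rewrite ltnS leq_addr.
pose c : 'I_top_height.+1 := Ordinal hN.
have Gpt (a : 'I_top_height.+1) : carrier H (point k0 k0 0 a%:R) \/
    carrier M (point k0 k0 0 a%:R).
  suff : carrier (stack K) (point k0 k0 0 a%:R) by rewrite GE.
  by apply: vertex_in_stack; lra.
have low k : exists2 j : nat, ((ord0 : 'I_top_height.+1) <= j < c)%N & gap_vertex j = k.
  by have [j jh jk] := gap_vertex_lower k; exists j.
have high k : exists2 j : nat, (c <= j < (ord_max : 'I_top_height.+1))%N & gap_vertex j = k.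
  exact: gap_vertex_upper.
have all k : exists2 j : nat,
    ((ord0 : 'I_top_height.+1) <= j < (ord_max : 'I_top_height.+1))%N & gap_vertex j = k.
  by have [j /andP[_ jh] jk] := gap_vertex_upper k; exists j.
have big (G : hyper) : carrier G `<=` carrier (stack K) ->
    e <= excess (carrier (stack K)) (carrier G) -> forall a b : 'I_top_height.+1,
    (forall k, exists2 j : nat, (a <= j < b)%N & gap_vertex j = k) ->
    carrier G (point k0 k0 0 a%:R) -> carrier G (point k0 k0 0 b%:R) -> False.
  move=> GK eG a b ab Ga Gb.
  by have := excess_two_levels Kk0 GK Ga Gb ab; rewrite leNgt (lt_le_trans mue).
have bigH := big H _ HG; have bigM := big M _ MG.
have {}bigH := bigH (fun y Hy => eq_ind_r (fun S => S y) (or_introl Hy) GE).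
have {}bigM := bigM (fun y My => eq_ind_r (fun S => S y) (or_intror My) GE).
by case: (Gpt ord0) (Gpt c) (Gpt ord_max) => [p|p] [p'|p'] [p''|p''];
  solve [exact: bigH low p p'|exact: bigM low p p'|exact: bigH high p' p''|
  exact: bigM high p' p''|exact: bigH all p p''|exact: bigM all p p''].
Qed.

End stack.

(** * Decomposable continua form a sigma-Z set *)

(** In the finite-dimensional case all coordinates are kept and no tail is
    left. *)
Lemma tail_coordinates (R : realType) (n : dimension) (mu : R) :
  0 < mu -> at_least_dim 3 n ->
  exists2 m, (2 <= m)%N & forall i : cube_index n,
    (m < index_rank i)%N -> 2^-1 ^+ index_rank i <= mu.
Proof.
move=> mu0; case: n => [p|] /= n3.
  exists p.-1; first by case: p n3 => [|[|[|]]].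
  by move=> i; rewrite ltnNge -ltnS prednK ?ltn_ord// (leq_trans _ n3).
have [N Nmu] : exists N, 2^-1 ^+ N < mu.
  exists (Num.bound mu^-1).
  rewrite exprVn invf_plt ?posrE ?exprn_gt0//.
  by apply: upper_nthrootP.
exists (maxn 2 N); first exact: leq_maxl.
move=> i; rewrite gtn_max => /andP[_ Ni]; apply: le_trans (ltW Nmu).
by rewrite ler_wiXn2l ?invf_le1 ?ler1n// ltnW.
Qed.

Lemma index_of_rank (n : dimension) r : at_least_dim 3 n -> (r < 3)%N ->
  exists i : cube_index n, index_rank i = r.
Proof.
case: n => [p|] /= n3 r3; last by exists r.
by exists (Ordinal (leq_trans r3 n3)).
Qed.

Lemma Z_set_coarsely_decomposable (R : realType) (n : dimension) (e : R) :
  0 < e -> at_least_dim 3 n ->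
  Z_set (coarsely_decomposable e : set (hyperspaceC (cube R n))).
Proof.
move=> e0 n3; split; first exact/closed_coarsely_decomposable/cube_compact.
move=> eps eps0; pose mu := Num.min e eps / 14%:R.
have min0 : 0 < Num.min e eps by rewrite lt_min e0.
have mu0 : 0 < mu by rewrite divr_gt0.
have mue : 14%:R * mu <= e by rewrite mulrC divfK ?pnatr_eq0// ge_min lexx.
have mueps : 14%:R * mu <= eps by rewrite mulrC divfK ?pnatr_eq0// ge_min lexx orbT.
have [m m2 tail] := tail_coordinates mu0 n3.
pose q := Num.truncn mu^-1.
have mesh : q.+1%:R^-1 <= mu.
  rewrite -[leRHS]invrK lef_pV2 ?posrE ?invr_gt0//; exact/ltW/Num.Theory.truncnS_gt.
have net x : exists k, mdist (@node R n m q (@spacing R m q) k) x <= mu.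
  exact: node_net mesh tail.
exists (stack mu0 net); split.
- exact: stack_continuous.
- apply/seteqP; split=> // _ [[K _ <-]].
  apply: stack_not_coarsely_decomposable => //; first by move=> r; exact: index_of_rank.
  lra.
apply: le_lt_trans (_ : (11 * mu)%:E < _)%E; last by rewrite lte_fin; lra.
by apply: ge_ereal_sup => _ [K _ <-]; rewrite lee_fin; exact: mdist_stack.
Qed.

Theorem proposition2p2 (R : realType) (n : dimension) :
  at_least_dim 2 n ->
  [/\ wilder_continua R n `<=` decomposable_continua R n,
      cw_wilder_continua R n `<=` decomposable_continua R n,
      arcwise_connected_continua R n `<=` decomposable_continua R n &
      hereditarily_arcwise_connected_continua R n
        `<=` decomposable_continua R n] /\
  (at_least_dim 3 n -> sigma_Z_set (decomposable_continua R n)).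
Proof.
move=> _; have cX := @cube_compact R n; split.
  split=> A.
  - exact: wilder_decomposable cX (carrierP A).
  - by move=> /cw_wilder_wilder; exact: wilder_decomposable cX (carrierP A).
  - by case; exact: arcwise_connected_decomposable cX (carrierP A).
  - move=> [ndegA HA]; apply: (arcwise_connected_decomposable cX (carrierP A) ndegA).
    by apply: HA => //; exact: carrierP.
move=> n3; exists (fun i => coarsely_decomposable i.+1%:R^-1); split.
  by move=> i; apply: Z_set_coarsely_decomposable => //; rewrite invr_gt0.
exact: decomposableE.
Qed.
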